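(* Let $$b_a=\frac{\frac{\partial}{\partial y}\zeta(6,iy)}{\frac{\partial}{\partial y}\zeta(3,iy)}\Big|_{y=1}=4.0774\cdots.$$ Then $\min_{z\in\Gamma_a}\big(\zeta(6,z)-b\zeta(3,z)\big)$ is achieved at $z=i$ if $b\le b_a$, and at $z=iy_b$ with $y_b>1$ if $b>b_a$. Moreover $\frac{dy_b}{db}>0$ and $\lim_{b\to\infty}\frac{y_b}{\sqrt[3]{\frac{\xi(6)}{2\xi(12)}\,b}}=1$.
   Context: For $s>1$ and $z$ with $\Im z>0$, $\zeta(s,z)=\sum_{(m,n)\in\mathbb{Z}^2\setminus\{0\}}\frac{(\Im z)^s}{|mz+n|^{2s}}$; $\xi$ is the Riemann zeta function. $\Gamma_a=\{z:\Re z=0,\ \Im z\ge1\}$. At $y=1$ both $\frac{\partial}{\partial y}\zeta(6,iy)$ and $\frac{\partial}{\partial y}\zeta(3,iy)$ vanish; the quotient defining $b_a$ is understood as its limiting value at $y=1$. *)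

(* Defs.v *)
From mathcomp Require Import all_boot all_order all_algebra.
From mathcomp Require Import all_classical all_reals all_analysis.
Set Implicit Arguments. Unset Strict Implicit. Unset Printing Implicit Defensive.
Import Order.TTheory GRing.Theory Num.Theory.
Import numFieldNormedType.Exports.
Local Open Scope classical_set_scope.
Local Open Scope ring_scope.

(* Epstein zeta function of the lattice Z + zZ, z = x + i y with y > 0:
   zeta(s,z) = sum_{(m,n) in Z^2 \ {0}} (Im z)^s / |m z + n|^(2s),
   with |m z + n|^2 = (m x + n)^2 + (m y)^2.  The sum is an (unordered)
   sum of nonnegative terms, computed with esum in \bar R, then cast to R. *)
Definition epstein_zeta {R : realType} (s x y : R) : R :=
  fine (esum [set p : int * int | p != (0%R, 0%R)]
    (fun p => ((y `^ s) /
       ((((p.1)%:~R * x + (p.2)%:~R) ^+ 2 + ((p.1)%:~R * y) ^+ 2) `^ s))%:E)).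

Definition zeta_iy {R : realType} (s y : R) : R := epstein_zeta s 0 y.

Definition riemann_zeta {R : realType} (s : R) : R :=
  fine (esum [set n : nat | (0 < n)%N] (fun n => ((n%:R : R) `^ (- s))%:E)).

(* Gamma_a = { z : Re z = 0, Im z >= 1 }, parametrized by y = Im z >= 1. *)
Definition Gamma_a_y {R : realType} : set R := [set y : R | 1 <= y].

Definition Wb {R : realType} (b y : R) : R := zeta_iy 6 y - b * zeta_iy 3 y.

(* Main.v *)
(** Put y = e^t.  Splitting off the terms with m n = 0,
      zeta(s, i e^t) = 2 xi(2s) (e^{st} + e^{-st}) + 4 sum_{m,n >= 1} q^{-s},
    with q = m^2 e^t + n^2 e^{-t}.  If w = (m^2 e^t - n^2 e^{-t}) / q, then
    q' = w q, w' = 1 - w^2 and |w| <= 1, so that d/dt maps q^{-s} p(w) to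
    q^{-s} (D p)(w) for an explicit operator D on polynomials; as q >= 2 m n, every
    t-derivative of the double sum is bounded uniformly in t.
    Let F, G be the functions of t for s = 6 and s = 3.  The exponential parts
    dominate so strongly that F''' G' - F' G''' > 0 for t > 0.  This is the derivative
    of F'' G' - F' G'', which vanishes at 0; hence F'/G' is strictly increasing on
    (0, +oo), from b_a = F''(0)/G''(0) to +oo.  As (F - b G)' = G' (F'/G' - b), the
    minimum is at t = 0 for b <= b_a, and otherwise at the unique solution of
    F'/G' = b, to which the inverse function theorem applies.  The asymptotics follow
    from F'/G' ~ 2 (xi(12)/xi(6)) e^{3t}.  Finally b_a is enclosed by summing over
    m, n <= 40 in integer arithmetic and bounding the tails. *)
Require Import Defs.
From Stdlib Require Import ZArith Lia.
From mathcomp Require Import all_boot all_order all_algebra.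
From mathcomp Require Import all_classical all_reals all_analysis.
From mathcomp Require Import ring lra.
From mathcomp Require Import ssrZ.
Import Order.TTheory GRing.Theory Num.Theory.
Import numFieldNormedType.Exports.
Local Open Scope classical_set_scope.
Local Open Scope ring_scope.

Set Implicit Arguments.
Unset Strict Implicit.
Unset Printing Implicit Defensive.

(** * Double series as limits of square partial sums *)

(** Telescoping: [1/(x+1)^2 <= 1/x - 1/(x+1)], so induction yields the sharper bound
    [1/a - 1/(a+n)]. *)
Lemma sum_inv_sqr_le (R : realType) (a : R) (n : nat) : 0 < a ->
  \sum_(i < n) ((a + i.+1%:R) ^+ 2)^-1 <= a^-1.
Proof.
move=> a0.
suff : \sum_(i < n) ((a + i.+1%:R) ^+ 2)^-1 <= a^-1 - (a + n%:R)^-1.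
  by move=> /le_trans; apply; rewrite gerBl invr_ge0 addr_ge0// ltW.
elim: n => [|n IHn]; first by rewrite big_ord0 addr0 subrr.
rewrite big_ord_recr/=; apply: (le_trans (lerD IHn (lexx _))).
rewrite -natr1 addrA; set x := a + n%:R.
have x0 : 0 < x by rewrite ltr_wpDr.
rewrite -subr_ge0.
have -> : a^-1 - (x + 1)^-1 - (a^-1 - x^-1 + ((x + 1) ^+ 2)^-1) =
  (x * (x + 1) ^+ 2)^-1.
  by field; rewrite !gt_eqF// addr_gt0.
by rewrite invr_ge0 mulr_ge0 ?sqr_ge0// ltW.
Qed.

Lemma sum_inv_sqrS_le2 (R : realType) (n : nat) :
  \sum_(i < n) ((i.+1%:R : R) ^+ 2)^-1 <= 2.
Proof.
case: n => [|n]; first by rewrite big_ord0.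
rewrite big_ord_recl/= expr1n invr1 -[2]/(1 + 1) lerD2l.
apply: le_trans (_ : 1^-1 <= 1); last by rewrite invr1.
apply: le_trans (sum_inv_sqr_le n ltr01).
by apply: ler_sum => i _; rewrite /bump/= add1n -natr1 addrC.
Qed.

Definition sq_sum {R : realType} (u : nat -> nat -> R) (n : nat) : R :=
  \sum_(i < n) \sum_(j < n) u i j.

(** A limit along growing squares; domination by [wt] below guarantees that it exists. *)
Definition dsum {R : realType} (u : nat -> nat -> R) : R := limn (sq_sum u).

Definition wt {R : realType} (i j : nat) : R :=
  (i.+1%:R ^+ 2)^-1 * (j.+1%:R ^+ 2)^-1.

Definition dominated {R : realType} (C : R) (u : nat -> nat -> R) : Prop :=
  forall i j, `|u i j| <= C * wt i j.

Lemma wt_ge0 (R : realType) (i j : nat) : 0 <= wt i j :> R.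
Proof. by rewrite mulr_ge0// invr_ge0 exprn_ge0. Qed.

Lemma sq_sumD (R : realType) (u v : nat -> nat -> R) :
  sq_sum (fun i j => u i j + v i j) = sq_sum u \+ sq_sum v.
Proof.
apply/funext => n; rewrite /sq_sum/= -big_split/=.
by apply: eq_bigr => i _; rewrite big_split.
Qed.

Lemma sq_sumZ (R : realType) (a : R) (u : nat -> nat -> R) :
  sq_sum (fun i j => a * u i j) = a \*o sq_sum u.
Proof.
apply/funext => n; rewrite /sq_sum/= mulr_sumr.
by apply: eq_bigr => i _; rewrite mulr_sumr.
Qed.

Lemma ler_sq_sum (R : realType) (u v : nat -> nat -> R) (n : nat) :
  (forall i j, u i j <= v i j) -> sq_sum u n <= sq_sum v n.
Proof. by move=> uv; apply: ler_sum => i _; apply: ler_sum => j _. Qed.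

(** The weight is a product, so its square sum is the square of a sum bounded by 2. *)
Lemma sq_sum_wt (R : realType) (n : nat) : sq_sum wt n <= 4 :> R.
Proof.
have s0 : 0 <= \sum_(i < n) ((i.+1%:R : R) ^+ 2)^-1.
  by apply: sumr_ge0 => i _; rewrite invr_ge0 exprn_ge0.
have -> : sq_sum wt n = (\sum_(i < n) ((i.+1%:R : R) ^+ 2)^-1) ^+ 2.
  rewrite /sq_sum expr2 mulr_suml; apply: eq_bigr => i _.
  by rewrite mulr_sumr.
have -> : 4 = 2 ^+ 2 :> R by ring.
by rewrite lerXn2r ?nnegrE ?sum_inv_sqrS_le2//.
Qed.

Lemma nondecreasing_sq_sum (R : realType) (u : nat -> nat -> R) :
  (forall i j, 0 <= u i j) -> nondecreasing_seq (sq_sum u).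
Proof.
move=> u0; apply/nondecreasing_seqP => n.
rewrite /sq_sum big_ord_recr/= ler_wpDr ?sumr_ge0//.
by apply: ler_sum => i _; rewrite big_ord_recr/= ler_wpDr.
Qed.

Lemma nneg_sq_sum_cvg (R : realType) (B : R) (u : nat -> nat -> R) :
  (forall i j, 0 <= u i j) -> (forall n, sq_sum u n <= B) ->
  sq_sum u n @[n --> \oo] --> dsum u.
Proof.
move=> u0 uB; apply: nondecreasing_is_cvgn; first exact: nondecreasing_sq_sum.
by exists B => _ [n _ <-].
Qed.

(** Write [u = (u + C wt) - C wt]: both parts are nonnegative with bounded square sums, hence
    converge monotonically. *)
Lemma dsum_cvg (R : realType) (C : R) (u : nat -> nat -> R) :
  dominated C u -> sq_sum u n @[n --> \oo] --> dsum u.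
Proof.
move=> uC; have C0 : 0 <= C.
  by have := le_trans (normr_ge0 _) (uC 0 0); rewrite /wt !expr1n invr1 !mulr1.
have Cw n : sq_sum (fun i j => C * wt i j) n <= C * 4.
  by rewrite sq_sumZ/= ler_wpM2l// sq_sum_wt.
have c1 : cvgn (sq_sum (fun i j => C * wt i j)).
  apply/cvg_ex; eexists; apply: nneg_sq_sum_cvg Cw => i j.
  by rewrite mulr_ge0// wt_ge0.
have c2 : cvgn (sq_sum (fun i j => u i j + C * wt i j)).
  apply/cvg_ex; eexists; apply: (@nneg_sq_sum_cvg _ (2 * (C * 4))) => [i j|n].
    by have /ler_normlP[] := uC i j; lra.
  rewrite sq_sumD/= mulr2n mulrDl !mul1r lerD//.
  apply: le_trans (Cw n); apply: ler_sq_sum => i j.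
  exact: le_trans (ler_norm _) (uC i j).
rewrite /dsum; suff : cvgn (sq_sum u) by [].
have -> : sq_sum u = (sq_sum (fun i j => u i j + C * wt i j) \-
    sq_sum (fun i j => C * wt i j)) by rewrite sq_sumD; apply/funext => n /=; lra.
exact: is_cvgB.
Qed.

Lemma dsum_le (R : realType) (B C : R) (u : nat -> nat -> R) :
  dominated C u -> (forall n, sq_sum u n <= B) -> dsum u <= B.
Proof.
move=> uC uB; apply: limr_le; first exact: dsum_cvg uC.
by apply: nearW.
Qed.

Lemma dsum_norm_le (R : realType) (C : R) (u : nat -> nat -> R) :
  dominated C u -> `|dsum u| <= 4 * C.
Proof.
move=> uC; have C0 : 0 <= C.
  by have := le_trans (normr_ge0 _) (uC 0 0); rewrite /wt !expr1n invr1 !mulr1.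
have h (v : nat -> nat -> R) n : dominated C v -> sq_sum v n <= 4 * C.
  move=> vC; apply: (@le_trans _ _ (sq_sum (fun i j => C * wt i j) n)).
    by apply: ler_sq_sum => i j; exact: le_trans (ler_norm _) (vC i j).
  by rewrite sq_sumZ/= mulrC ler_wpM2r// sq_sum_wt.
apply/ler_normlP; split; last by apply: (dsum_le uC) => n; apply: h.
rewrite lerNl; apply: limr_ge; first exact: dsum_cvg uC.
apply: nearW => n; rewrite lerNl.
have -> : - sq_sum u n = sq_sum (fun i j => -1 * u i j) n.
  by rewrite sq_sumZ/= mulN1r.
by apply: h => i j; rewrite mulN1r normrN.
Qed.

Lemma dominatedD (R : realType) (C C' : R) (u v : nat -> nat -> R) :
  dominated C u -> dominated C' v -> dominated (C + C') (fun i j => u i j + v i j).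
Proof. by move=> uC vC i j; rewrite mulrDl (le_trans (ler_normD _ _))// lerD. Qed.

Lemma dominatedZ (R : realType) (a C : R) (u : nat -> nat -> R) :
  dominated C u -> dominated (`|a| * C) (fun i j => a * u i j).
Proof. by move=> uC i j; rewrite normrM -mulrA ler_wpM2l. Qed.

Lemma dsumD (R : realType) (C C' : R) (u v : nat -> nat -> R) :
  dominated C u -> dominated C' v ->
  dsum (fun i j => u i j + v i j) = dsum u + dsum v.
Proof.
move=> uC vC; rewrite {1}/dsum sq_sumD; apply: cvg_lim => //.
by apply: cvgD; [exact: dsum_cvg uC|exact: dsum_cvg vC].
Qed.

Lemma dsumZ (R : realType) (a C : R) (u : nat -> nat -> R) :
  dominated C u -> dsum (fun i j => a * u i j) = a * dsum u.
Proof.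
move=> uC; rewrite {1}/dsum sq_sumZ; apply: cvg_lim => //.
by apply: cvgM; [exact: cvg_cst|exact: dsum_cvg uC].
Qed.

(** Summing over squares reduces the symmetry between m and n to an exchange of two finite sums. *)
Lemma dsum_swap (R : realType) (u : nat -> nat -> R) :
  dsum (fun i j => u j i) = dsum u.
Proof. by congr (limn _); apply/funext => n; rewrite /sq_sum exchange_big. Qed.

(** * Termwise differentiation of double series *)

Lemma mvt_norm (R : realType) (f f1 : R -> R) (a b : R) :
  (forall x : R, is_derive x 1 f (f1 x)) ->
  exists2 c, `|c - a| <= `|b - a| & f b - f a = f1 c * (b - a).
Proof.
move=> fE.
have cf x y : {within `[x, y], continuous f}.
  apply: derivable_within_continuous => z _.
  by have := fE z => -[].
have [ab|ba] := leP a b.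
  have [c] := MVT_segment ab (fun x _ => fE x) (cf a b).
  rewrite in_itv/= => /andP[ac cb] E; exists c => //.
  by rewrite !ger0_norm ?subr_ge0// lerD2r.
have [c] := MVT_segment (ltW ba) (fun x _ => fE x) (cf b a).
rewrite in_itv/= => /andP[ac cb] E; exists c.
  by rewrite !ler0_norm ?subr_le0// ?(ltW ba)// lerN2 lerD2r.
by rewrite -[LHS]opprB E -mulrN opprB.
Qed.

(** Two applications of the mean value theorem; they give the constant [B] instead of [B/2], which
    is enough. *)
Lemma taylor1_norm_le (R : realType) (f f1 f2 : R -> R) (B : R) :
  (forall x : R, is_derive x 1 f (f1 x)) -> (forall x : R, is_derive x 1 f1 (f2 x)) ->
  (forall x, `|f2 x| <= B) ->
  forall t h, `|f (t + h) - f t - h * f1 t| <= B * h ^+ 2.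
Proof.
move=> fE f1E f2B t h.
have [c ct E] := mvt_norm t (t + h) fE.
have [d _ E'] := mvt_norm t c f1E.
rewrite E addrAC subrr add0r mulrC -mulrBr E' normrM.
rewrite addrAC subrr add0r in ct.
rewrite normrM -(real_normK (num_real h)) expr2 mulrCA ler_pM ?mulr_ge0//.
by rewrite ler_pM.
Qed.

(** Differentiability from a quadratic error bound, a form that survives summation of the terms. *)
Lemma is_derive_quadratic (R : realType) (F : R -> R) (t l K : R) :
  (forall h, `|F (t + h) - F t - h * l| <= K * h ^+ 2) -> is_derive t 1 F l.
Proof.
move=> H.
have K0 : 0 <= K by have := H 1; rewrite expr1n mulr1; exact: le_trans.
have L : h^-1 *: ((F \o shift t) h%:A - F t) @[h --> 0^'] --> l.
  apply/cvgrPdist_le => e e0; near=> h.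
  have h0 : h != 0 by near: h; exact: nbhs_dnbhs_neq.
  rewrite /= /GRing.scale/= mulr1 [h + t]addrC -normrN opprB.
  have -> : h^-1 * (F (t + h) - F t) - l = h^-1 * (F (t + h) - F t - h * l).
    by field.
  rewrite normrM normfV mulrC ler_pdivrMr ?normr_gt0//.
  apply: (le_trans (H h)); rewrite -(real_normK (num_real h)) expr2 mulrA ler_wpM2r//.
  have hd : `|h| <= e / (K + 1).
    by near: h; apply: dnbhs0_le; rewrite divr_gt0// ltr_wpDl.
  have K1 : 0 < K + 1 by rewrite ltr_wpDl.
  apply: (@le_trans _ _ ((K + 1) * (e / (K + 1)))); last by rewrite mulrC divfK ?gt_eqF.
  by apply: ler_pM => //; rewrite lerDl.
by split; [apply/cvg_ex; exists l|exact: cvg_lim].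
Unshelve. all: by end_near.
Qed.

(** The bound on second derivatives makes each Taylor remainder at most [C wt h^2], so the
    remainders add up to at most [4 C h^2]. *)
Lemma is_derive_dsum (R : realType) (C : R) (f f1 f2 : R -> nat -> nat -> R) :
  (forall i j (t : R), is_derive t 1 (fun t => f t i j) (f1 t i j)) ->
  (forall i j (t : R), is_derive t 1 (fun t => f1 t i j) (f2 t i j)) ->
  (forall t, dominated C (f t)) -> (forall t, dominated C (f1 t)) ->
  (forall t, dominated C (f2 t)) ->
  forall t : R, is_derive t 1 (fun t => dsum (f t)) (dsum (f1 t)).
Proof.
move=> fE f1E fC f1C f2C t; apply: (@is_derive_quadratic _ _ _ _ (4 * C)) => h.
have nfC t' := dominatedZ (-1) (fC t'); have hfC := dominatedZ (- h) (f1C t).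
have -> : dsum (f (t + h)) - dsum (f t) - h * dsum (f1 t) =
    dsum (fun i j => (f (t + h) i j + -1 * f t i j) + - h * f1 t i j).
  rewrite (dsumD (dominatedD (fC (t + h)) (nfC t)) hfC).
  by rewrite (dsumD (fC _) (nfC t)) (dsumZ _ (fC _)) (dsumZ _ (f1C _)); ring.
rewrite -mulrA; apply: dsum_norm_le => i j.
have := @taylor1_norm_le _ _ _ _ (C * wt i j) (fE i j) (f1E i j)
  (fun x => f2C x i j) t h.
by rewrite mulN1r mulNr mulrAC.
Qed.

(** * The lattice sum over m, n >= 1 and its derivatives *)

Lemma is_derive_congr (R : realType) (f g : R -> R) (x l m : R) :
  is_derive x 1 f l -> f = g -> l = m -> is_derive x 1 g m.
Proof. by move=> + <- <-. Qed.

Lemma is_derive_expRN (R : realType) (x : R) :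
  is_derive x 1 (fun t => expR (- t)) (- expR (- x)).
Proof.
have h : is_derive x 1 (-%R : R -> R) (-1).
  by apply: (is_derive_congr (f := - (@id R)) (l := - 1)).
apply: (is_derive_congr (is_derive1_comp (is_derive_expR (- x)) h)) => //.
by rewrite mulrN1.
Qed.

Lemma poly_bounded (R : realType) (p : {poly R}) :
  exists C : R, forall x : R, `|x| <= 1 -> `|p.[x]| <= C.
Proof.
exists (\sum_(i < size p) `|p`_i|) => x x1; rewrite horner_coef.
apply: (le_trans (ler_norm_sum _ _ _)); apply: ler_sum => i _.
by rewrite normrM normrX ler_piMr// exprn_ile1.
Qed.

(* The index i stands for m - 1, and j for n - 1. *)
Definition qf {R : realType} (i j : nat) (t : R) : R :=
  i.+1%:R ^+ 2 * expR t + j.+1%:R ^+ 2 * expR (- t).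

Definition wf {R : realType} (i j : nat) (t : R) : R :=
  (i.+1%:R ^+ 2 * expR t - j.+1%:R ^+ 2 * expR (- t)) / qf i j t.

Definition term {R : realType} (s : nat) (p : {poly R}) (t : R) (i j : nat) : R :=
  (qf i j t ^+ s)^-1 * p.[wf i j t].

Definition phi {R : realType} (s : nat) (p : {poly R}) (t : R) : R :=
  dsum (term s p t).

(* d/dt [q^-s p(w)] = q^-s (dpoly s p)(w), because q' = w q and w' = 1 - w^2. *)
Definition dpoly {R : realType} (s : nat) (p : {poly R}) : {poly R} :=
  p^`() * (1 - 'X^2) - s%:R * ('X * p).

Lemma qf_ge (R : realType) (i j : nat) (t : R) :
  2 * (i.+1%:R * j.+1%:R) <= qf i j t.
Proof.
rewrite /qf -subr_ge0; set x := i.+1%:R : R; set y := j.+1%:R : R.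
have e : expR t = expR (t / 2) ^+ 2 by rewrite -expRM_natl; congr expR; field.
have e' : expR (- t) = (expR (t / 2) ^+ 2)^-1 by rewrite expRN e.
have e0 : expR (t / 2) != 0 by rewrite gt_eqF// expR_gt0.
(* The arithmetic-geometric mean inequality, with the difference written as a square. *)
suff -> : x ^+ 2 * expR t + y ^+ 2 * expR (- t) - 2 * (x * y) =
    (x * expR (t / 2) - y / expR (t / 2)) ^+ 2 by exact: sqr_ge0.
by rewrite e' e; field.
Qed.

Lemma qf_gt0 (R : realType) (i j : nat) (t : R) : 0 < qf i j t.
Proof. by apply: lt_le_trans (qf_ge i j t); rewrite !mulr_gt0. Qed.

Lemma wf_norm (R : realType) (i j : nat) (t : R) : `|wf i j t| <= 1.
Proof.
rewrite /wf normrM normfV [X in _ / X]gtr0_norm ?qf_gt0//.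
rewrite ler_pdivrMr ?qf_gt0// mul1r.
have h1 : 0 <= i.+1%:R ^+ 2 * expR t by rewrite mulr_ge0 ?sqr_ge0 ?expR_ge0.
have h2 : 0 <= j.+1%:R ^+ 2 * expR (- t) by rewrite mulr_ge0 ?sqr_ge0 ?expR_ge0.
by rewrite /qf; apply/ler_normlP; split; lra.
Qed.

Lemma is_derive_qf (R : realType) (i j : nat) (t : R) :
  is_derive t 1 (qf i j) (wf i j t * qf i j t).
Proof.
apply: (is_derive_congr (is_deriveD
  (is_deriveZ (i.+1%:R ^+ 2) (is_derive_expR t))
  (is_deriveZ (j.+1%:R ^+ 2) (is_derive_expRN t)))) => //.
by rewrite /wf divfK ?gt_eqF ?qf_gt0// /GRing.scale/= mulrN.
Qed.

Lemma is_derive_wf (R : realType) (i j : nat) (t : R) :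
  is_derive t 1 (wf i j) (1 - wf i j t ^+ 2).
Proof.
have q0 : qf i j t != 0 by rewrite gt_eqF ?qf_gt0.
(* The numerator [r = w q] satisfies [r' = q], so the quotient rule gives
   [1 - r q' / q^2 = 1 - w^2]. *)
pose r (t : R) := i.+1%:R ^+ 2 * expR t - j.+1%:R ^+ 2 * expR (- t).
have hr : is_derive t 1 r (qf i j t).
  apply: (is_derive_congr (is_deriveB
    (is_deriveZ (i.+1%:R ^+ 2) (is_derive_expR t))
    (is_deriveZ (j.+1%:R ^+ 2) (is_derive_expRN t)))) => //.
  by rewrite /qf /GRing.scale/= mulrN opprK.
apply: (is_derive_congr (is_deriveM hr (is_deriveV q0 (is_derive_qf i j t)))) => //.
by rewrite /GRing.scale/= /wf -/(r t); field.
Qed.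

Lemma is_derive_term (R : realType) (s : nat) (p : {poly R}) (i j : nat) (t : R) :
  is_derive t 1 (fun t => term s p t i j) (term s (dpoly s p) t i j).
Proof.
have q0 : qf i j t != 0 by rewrite gt_eqF ?qf_gt0.
have qs0 : qf i j t ^+ s != 0 by rewrite expf_neq0.
have qs0' : (qf i j ^+ s) t != 0 by rewrite exprfctE.
have hX := is_deriveX s (is_derive_qf i j t).
have hp := is_derive1_comp (is_derive_poly p (wf i j t)) (is_derive_wf i j t).
apply: (is_derive_congr (is_deriveM (is_deriveV qs0' hX) hp)).
  by apply/funext => x; rewrite /term/= exprfctE.
rewrite exprfctE /term /dpoly /GRing.scale/=.
set x := wf i j t; set q := qf i j t in q0 qs0 *.
rewrite !(hornerE, hornerXn, hornerMn) /=.
(* The derivative of [q^s] carries the truncated exponent [s.-1], so [s = 0] is treated apart. *)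
case: s {hX qs0'} qs0 => [|s] qs0.
  by rewrite /= !expr0 invr1; ring.
rewrite exprS /=; field.
by rewrite q0 expf_neq0.
Qed.

(** From [q >= 2 m n] and [s >= 2], [q^-s <= 2^-s (m n)^-2], uniformly in t. *)
Lemma term_dominated (R : realType) (s : nat) (p : {poly R}) (C t : R) :
  (2 <= s)%N -> (forall x : R, `|x| <= 1 -> `|p.[x]| <= C) ->
  dominated (C / 2 ^+ s) (term s p t).
Proof.
move=> s2 pC i j; rewrite /term normrM mulrC -mulrA.
apply: ler_pM => //; first exact/pC/wf_norm.
rewrite normfV normrX gtr0_norm ?qf_gt0//.
have n0 : 0 < i.+1%:R * j.+1%:R :> R by rewrite mulr_gt0.
rewrite /wt -invfM -exprMn -invfM lef_pV2 ?posrE ?mulr_gt0 ?exprn_gt0 ?qf_gt0//.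
apply: (@le_trans _ _ ((2 * (i.+1%:R * j.+1%:R)) ^+ s)).
  rewrite [leRHS]exprMn ler_wpM2l ?exprn_ge0// ler_weXn2l//.
  by rewrite -natrM ler1n muln_gt0.
by rewrite lerXn2r ?nnegrE ?qf_ge// ltW ?qf_gt0// mulr_gt0.
Qed.

Lemma phi_norm_le (R : realType) (s : nat) (p : {poly R}) (C t : R) :
  (2 <= s)%N -> (forall x : R, `|x| <= 1 -> `|p.[x]| <= C) ->
  `|phi s p t| <= 4 * (C / 2 ^+ s).
Proof. by move=> s2 pC; apply/dsum_norm_le/term_dominated. Qed.

(** Since [|w| <= 1], one constant bounds [p] and its first two images under [dpoly], and termwise
    differentiation applies. *)
Lemma is_derive_phi (R : realType) (s : nat) (p : {poly R}) (t : R) :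
  (2 <= s)%N -> is_derive t 1 (phi s p) (phi s (dpoly s p) t).
Proof.
move=> s2.
have [C0 h0] := poly_bounded p.
have [C1 h1] := poly_bounded (dpoly s p).
have [C2 h2] := poly_bounded (dpoly s (dpoly s p)).
pose C := Num.max C0 (Num.max C1 C2).
apply: (@is_derive_dsum R (C / 2 ^+ s) (term s p) (term s (dpoly s p))
  (term s (dpoly s (dpoly s p)))).
- by move=> i j x; exact: is_derive_term.
- by move=> i j x; exact: is_derive_term.
- by move=> x; apply: term_dominated => // y /h0 /le_trans; apply; rewrite !le_max lexx.
- by move=> x; apply: term_dominated => // y /h1 /le_trans; apply; rewrite !le_max lexx ?orbT.
- by move=> x; apply: term_dominated => // y /h2 /le_trans; apply; rewrite !le_max lexx ?orbT.
Qed.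

(** At [t = 0], exchanging m and n keeps q and negates w, so for odd [p] the sum equals its own
    opposite. *)
Lemma phi_odd0 (R : realType) (s : nat) (p : {poly R}) :
  (2 <= s)%N -> (forall x, p.[- x] = - p.[x]) -> phi s p 0 = 0.
Proof.
move=> s2 podd; have [C pC] := poly_bounded p.
suff h : phi s p 0 = -1 * phi s p 0 by lra.
rewrite {2}/phi -(dsumZ _ (term_dominated 0 s2 pC)) -dsum_swap.
congr dsum; apply/funext => i; apply/funext => j; rewrite /term.
have qE : qf j i 0 = qf i j 0 :> R by rewrite /qf oppr0 expR0 addrC.
have -> : wf j i 0 = - wf i j 0 :> R.
  by rewrite /wf qE -[RHS]mulNr opprB oppr0 expR0.
by rewrite qE podd; ring.
Qed.

(** The mean value theorem from 0, where the sum vanishes. A bound linear in t can be compared with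
    [sinh(s t)] down to [t = 0]. *)
Lemma phi_odd_le (R : realType) (s : nat) (p : {poly R}) (C t : R) :
  (2 <= s)%N -> (forall x, p.[- x] = - p.[x]) ->
  (forall x : R, `|x| <= 1 -> `|(dpoly s p).[x]| <= C) ->
  `|phi s p t| <= 4 * (C / 2 ^+ s) * `|t|.
Proof.
move=> s2 podd pC.
have [c _] := mvt_norm 0 t (fun x => is_derive_phi p x s2).
rewrite !subr0 phi_odd0// subr0 => ->; rewrite normrM ler_wpM2r//.
exact: phi_norm_le.
Qed.

(** * Decomposition of the Epstein zeta function *)

Definition zpart {R : realType} (s n : nat) : R :=
  \sum_(i < n) (i.+1%:R ^+ s)^-1.

Definition zsum {R : realType} (s : nat) : R := limn (zpart s).

Lemma zsum_partial_le2 (R : realType) (s n : nat) : (2 <= s)%N ->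
  zpart s n <= 2 :> R.
Proof.
move=> s2; apply: le_trans (sum_inv_sqrS_le2 R n); apply: ler_sum => i _.
by rewrite lef_pV2 ?posrE ?exprn_gt0// ler_weXn2l// ler1n.
Qed.

Lemma zsum_nondecreasing (R : realType) (s : nat) :
  nondecreasing_seq (@zpart R s).
Proof.
by apply/nondecreasing_seqP => n; rewrite /zpart big_ord_recr/= lerDl invr_ge0 exprn_ge0.
Qed.

Lemma zsum_cvg (R : realType) (s : nat) : (2 <= s)%N ->
  zpart s n @[n --> \oo] --> (zsum s : R).
Proof.
move=> s2; apply: nondecreasing_is_cvgn; first exact: zsum_nondecreasing.
by exists 2 => _ [n _ <-]; exact: zsum_partial_le2.
Qed.

Lemma zsum_ge (R : realType) (s n : nat) : (2 <= s)%N ->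
  zpart s n <= zsum s :> R.
Proof.
move=> s2; apply: nondecreasing_cvgn_le; first exact: zsum_nondecreasing.
exact: zsum_cvg.
Qed.

Lemma zsum_le (R : realType) (s : nat) (B : R) : (2 <= s)%N ->
  (forall n, zpart s n <= B :> R) -> zsum s <= B.
Proof.
by move=> s2 H; apply: limr_le; [exact: zsum_cvg|exact: nearW].
Qed.

Lemma esum_inv_exp (R : realType) (s : nat) (c : R) : (2 <= s)%N -> 0 <= c ->
  (\esum_(n in [set: nat]) (c * (n.+1%:R ^+ s)^-1)%:E = (c * zsum s)%:E)%E.
Proof.
move=> s2 c0; rewrite -nneseries_esumT; last first.
  by move=> n; rewrite lee_fin mulr_ge0// invr_ge0 exprn_ge0.
rewrite /zsum -[c * _]/(c *: _) -limZr; last exact: zsum_cvg.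
rewrite -EFin_lim; last by apply: is_cvgZr; exact: zsum_cvg.
congr (limn _); apply/funext => n /=.
by rewrite sumEFin big_mkord -mulr_sumr.
Qed.

Lemma set_bij_succ : set_bij [set: nat] [set n | (0 < n)%N] succn.
Proof.
by split=> [n _ //|m n _ _ []//|[|n] //= _]; exists n.
Qed.

Lemma riemann_zetaE (R : realType) (s : nat) : (2 <= s)%N ->
  riemann_zeta s%:R = zsum s :> R.
Proof.
move=> s2; rewrite /riemann_zeta (@reindex_esum _ _ _ _ _ _ _ set_bij_succ).
have -> : (fun n => ((n.+1%:R : R) `^ (- s%:R))%:E) =
    (fun n => (1 * (n.+1%:R ^+ s)^-1)%:E).
  by apply/funext => n; rewrite mul1r powRN powR_mulrn.
by rewrite esum_inv_exp// mul1r.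
Qed.

(** The positive integers are [Posz n.+1] and the negative ones [Negz n], which has absolute value
    [n + 1]; each sign contributes the same sum. *)
Lemma esum_int_neq0 (R : realType) (a : nat -> \bar R) :
  (forall n, 0 <= a n)%E ->
  (\esum_(m in [set m : int | m != 0%R]) a `|m|%N =
   \esum_(n in [set: nat]) a n.+1 + \esum_(n in [set: nat]) a n.+1)%E.
Proof.
move=> a0; rewrite (esumID [set m : int | (0 < m)%R])//; congr (_ + _)%E.
- rewrite (@reindex_esum _ _ _ [set: nat] _ (fun n => Posz n.+1))//.
  split=> [n _ //|m n _ _ []//|].
  by move=> [[|n]|n] /= [m0 mp] //; exists n.
- rewrite (@reindex_esum _ _ _ [set: nat] _ Negz)//.
  split=> [n _ //|m n _ _ []//|].
  by move=> [[|n]|n] /= [m0 mp] //; exists n.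
Qed.

Lemma esum_int (R : realType) (a : nat -> \bar R) : (forall n, 0 <= a n)%E ->
  (\esum_(m in [set: int]) a `|m|%N = a 0%N +
   (\esum_(n in [set: nat]) a n.+1 + \esum_(n in [set: nat]) a n.+1))%E.
Proof.
move=> a0; rewrite (esumID [set 0%R])//; congr (_ + _)%E.
  by rewrite setTI esum_set1.
rewrite -esum_int_neq0//; congr esum; apply/seteqP.
by split => m /=; [move=> [_ /eqP]|move=> /eqP].
Qed.

(** [A] is a half-axis with m = 0, [B] a half-axis with n = 0 and [C] an open quadrant. *)
Lemma esum_int2_neq0 (R : realType) (a : nat -> nat -> \bar R) :
  (forall m n, 0 <= a m n)%E ->
  let A := \esum_(n in [set: nat]) a 0%N n.+1 in
  let B := \esum_(m in [set: nat]) a m.+1 0%N in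
  let C := \esum_(m in [set: nat]) \esum_(n in [set: nat]) a m.+1 n.+1 in
  (\esum_(p in [set p : int * int | p != (0%R, 0%R)]) a `|p.1|%N `|p.2|%N =
   (A + A) + ((B + (C + C)) + (B + (C + C))))%E.
Proof.
move=> a0 A B C.
have C0 m : (0 <= \esum_(n in [set: nat]) a m n.+1)%E by apply: esum_ge0.
(* The fibre over m: only the one over [m = 0] misses a point, the origin. *)
pose J (m : int) := if m == 0 then [set n : int | n != 0%R] else setT.
have -> : [set p : int * int | p != (0%R, 0%R)] = [set: int] `*`` J.
  apply/seteqP; split => -[m n] /=; rewrite /setXR /J/= xpair_eqE.
    by case: eqP => //= _ h; split.
  by case: eqP => //= _ [].
rewrite -(@esum_esum _ _ _ _ _ (fun m n : int => a `|m|%N `|n|%N))//.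
rewrite (esumID [set 0%R]); last by move=> m _; apply: esum_ge0.
congr (_ + _)%E.
  rewrite setTI esum_set1; last by apply: esum_ge0.
  by rewrite /J eqxx (@esum_int_neq0 _ (a 0%N)).
pose b m := (a m 0%N + (\esum_(n in [set: nat]) a m n.+1 +
   \esum_(n in [set: nat]) a m n.+1))%E.
have b0 m : (0 <= b m)%E by rewrite !adde_ge0.
transitivity (\esum_(m in [set m : int | m != 0%R]) b `|m|%N).
  have -> : [set: int] `&` ~` [set 0%R] = [set m : int | m != 0%R].
    by apply/seteqP; split => m /=; [move=> [_ /eqP]|move=> /eqP].
  by apply: eq_esum => m /= /negbTE m0; rewrite /J m0 (@esum_int _ (a `|m|%N)).
rewrite esum_int_neq0//; congr (_ + _)%E; rewrite /b esumD//.
all: by rewrite ?esumD// => m _; rewrite adde_ge0.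
Qed.

(** As the terms are nonnegative, an m by n rectangle sums to at most the square of side [maxn m n],
    and each square to at most the iterated sum. *)
Lemma esum_esum_dsum (R : realType) (D : R) (u : nat -> nat -> R) :
  (forall i j, 0 <= u i j) -> dominated D u ->
  (\esum_(i in [set: nat]) \esum_(j in [set: nat]) (u i j)%:E = (dsum u)%:E)%E.
Proof.
move=> u0 uD.
have ue0 i j : (0 <= (u i j)%:E)%E by rewrite lee_fin.
have -> : (fun i => \esum_(j in [set: nat]) (u i j)%:E)%E =
    (fun i => \sum_(j <oo) (u i j)%:E)%E.
  by apply/funext => i; rewrite nneseries_esumT.
have s0 i : (0 <= \sum_(j <oo) (u i j)%:E)%E by apply: nneseries_ge0.
rewrite -nneseries_esumT//.
have uc := dsum_cvg uD.
have leD n : sq_sum u n <= dsum u.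
  by apply: nondecreasing_cvgn_le; [exact: nondecreasing_sq_sum|exact: uc].
apply/eqP; rewrite eq_le; apply/andP; split.
  apply: lime_le; first exact: is_cvg_nneseries.
  apply: nearW => m; rewrite -nneseries_sum_nat//.
  apply: lime_le; first by apply: is_cvg_nneseries => *; exact: sume_ge0.
  apply: nearW => n.
  under eq_bigr do rewrite sumEFin.
  rewrite sumEFin lee_fin; apply: le_trans (leD (maxn m n)).
  rewrite exchange_big/= /sq_sum !big_mkord.
  rewrite (big_ord_widen_cond (maxn m n) xpredT
    (fun i => \sum_(0 <= j < n) u i j) (leq_maxl m n)) big_mkcond/=.
  apply: ler_sum => i _; case: ifP => _; last exact: sumr_ge0.
  rewrite big_mkord (big_ord_widen_cond _ xpredT (u i) (leq_maxr m n)) big_mkcond/=.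
  by apply: ler_sum => j _; case: ifP.
rewrite /dsum -EFin_lim; last exact: uc.
have c : cvgn (EFin \o sq_sum u).
  have h : (EFin \o sq_sum u) n @[n --> \oo] --> (dsum u)%:E.
    by apply: cvg_EFin; [exact: nearW|exact: uc].
  exact: cvgP h.
apply: (lime_le c).
apply: nearW => n /=; apply: le_trans (nneseries_lim_ge n _) => //.
rewrite /sq_sum -sumEFin big_mkord; apply: lee_sum => i _.
rewrite -sumEFin -(big_mkord xpredT (fun j => (u i j)%:E)).
exact: nneseries_lim_ge.
Qed.

Lemma zeta_iy_expR (R : realType) (s : nat) (t : R) : (2 <= s)%N ->
  zeta_iy s%:R (expR t) =
  2 * zsum (2 * s) * (expR t ^+ s + expR (- t) ^+ s) + 4 * phi s 1 t.
Proof.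
move=> s2; set y := expR t.
have y0 : 0 < y by exact: expR_gt0.
have s2' : (2 <= 2 * s)%N by rewrite (leq_trans s2)// leq_pmull.
have ys0 : 0 <= y ^+ s by rewrite exprn_ge0// ltW.
have yE : expR (- t) = y^-1 by rewrite expRN.
pose b (m n : nat) : R := y ^+ s * ((n%:R ^+ 2 + (m%:R * y) ^+ 2) ^+ s)^-1.
pose a (m n : nat) : \bar R := (b m n)%:E.
have b0 m n : 0 <= b m n.
  by rewrite mulr_ge0// invr_ge0 exprn_ge0// addr_ge0// sqr_ge0.
have a0 m n : (0 <= a m n)%E by rewrite lee_fin.
rewrite /zeta_iy /epstein_zeta.
under eq_esum => p _.
  have -> : (y `^ s%:R / (((p.1)%:~R * 0 + (p.2)%:~R) ^+ 2 +
      ((p.1)%:~R * y) ^+ 2) `^ s%:R)%:E = a `|p.1|%N `|p.2|%N.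
    rewrite /a /b mulr0 add0r !powR_mulrn ?addr_ge0 ?sqr_ge0 ?(ltW y0)//.
    rewrite !exprMn -!(@real_normK _ (_ %:~R)) ?num_real//.
    by rewrite !natr_absz !intr_norm.
  over.
rewrite esum_int2_neq0//.
have bA n : b 0%N n.+1 = y ^+ s * (n.+1%:R ^+ (2 * s))^-1.
  by rewrite /b mul0r expr0n addr0 exprM.
have bB m : b m.+1 0%N = y^-1 ^+ s * (m.+1%:R ^+ (2 * s))^-1.
  rewrite /b expr0n/= add0r -exprM exprMn exprVn mul2n -addnn [y ^+ (s + s)]exprD.
  by field; rewrite !expf_neq0 ?pnatr_eq0// gt_eqF.
(* Dividing [n^2 + m^2 y^2] by y gives [q], so the factor [y^s] is absorbed into [q^-s]. *)
have bC m n : b m.+1 n.+1 = term s 1 t m n.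
  rewrite /b /term hornerC mulr1 -[y ^+ s]invrK -invfM; congr (_^-1).
  rewrite -exprVn -exprMn /qf yE -/y; congr (_ ^+ s); field.
  by rewrite gt_eqF.
under eq_esum do rewrite /a bA.
rewrite esum_inv_exp//.
under [X in (_ + (X + _ + _))%E]eq_esum do rewrite /a bB.
under [X in (_ + (_ + (X + _)))%E]eq_esum do rewrite /a bB.
rewrite esum_inv_exp; [|by []|by rewrite exprn_ge0// invr_ge0 ltW].
have tdom : dominated (1 / 2 ^+ s) (term s 1 t).
  by apply: term_dominated => // x _; rewrite hornerC normr1.
have t0 i j : 0 <= term s 1 t i j by rewrite -bC.
have hC : (\esum_(m in [set: nat]) \esum_(n in [set: nat]) a m.+1 n.+1 =
    (phi s 1 t)%:E)%E.
  rewrite /phi -(esum_esum_dsum t0 tdom); apply: eq_esum => m _.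
  by apply: eq_esum => n _; rewrite /a bC.
rewrite hC.
by rewrite -!EFinD /= yE; ring.
Qed.

(** * The Wronskian *)

(* The k-th derivative of t |-> zeta(s, i e^t). *)
Definition ef {R : realType} (s k : nat) (t : R) : R :=
  2 * zsum (2 * s) * s%:R ^+ k *
    (expR (s%:R * t) + (-1) ^+ k * expR (- (s%:R * t))) +
  4 * phi s (iter k (dpoly s) 1) t.

Lemma zeta_iy_ef (R : realType) (s : nat) (t : R) : (2 <= s)%N ->
  zeta_iy s%:R (expR t) = ef s 0 t.
Proof.
move=> s2; rewrite zeta_iy_expR// /ef expr0 mulr1 expr0 mul1r.
by rewrite -!expRM_natl mulrN.
Qed.

Lemma is_derive_expRZ (R : realType) (a t : R) :
  is_derive t 1 (fun t => expR (a * t)) (a * expR (a * t)).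
Proof.
have h : is_derive t 1 (fun t : R => a * t) a.
  apply: (is_derive_congr (is_deriveZ a (is_derive_id t 1))) => //.
  by rewrite /GRing.scale/= mulr1.
apply: (is_derive_congr (is_derive1_comp (is_derive_expR (a * t)) h)) => //.
by rewrite mulrC.
Qed.

Lemma is_derive_ef (R : realType) (s k : nat) (t : R) : (2 <= s)%N ->
  is_derive t 1 (ef s k) (ef s k.+1 t).
Proof.
move=> s2.
have h1 := is_derive_expRZ s%:R t.
have h2 := is_derive_expRZ (- s%:R) t.
have h3 := is_derive_phi (iter k (dpoly s) 1) t s2.
apply: (is_derive_congr (is_deriveD (is_deriveZ (2 * zsum (2 * s) * s%:R ^+ k)
  (is_deriveD h1 (is_deriveZ ((-1) ^+ k) h2))) (is_deriveZ 4 h3))).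
  apply/funext => x; rewrite /ef/= /GRing.scale/= -mulNr.
  by [].
by rewrite /ef /= /GRing.scale/= !exprS !mulNr; ring.
Qed.

Lemma dpoly1E (R : realType) (s : nat) : dpoly s 1 = - ('X *+ s) :> {poly R}.
Proof. by rewrite /dpoly -[1]/(1%:P) derivC polyC1; ring. Qed.

Lemma dpoly2E (R : realType) (s : nat) :
  iter 2 (dpoly s) 1 = 'X^2 *+ (s * s.+1) - 1 *+ s :> {poly R}.
Proof.
rewrite /= dpoly1E /dpoly derivN derivMn derivX.
by ring.
Qed.

Lemma dpoly3E (R : realType) (s : nat) :
  iter 3 (dpoly s) 1 =
  'X *+ (3 * s * s + 2 * s) - 'X^3 *+ (s * s.+1 * s.+2) :> {poly R}.
Proof.
rewrite [LHS]/= -[dpoly s (dpoly s 1)]/(iter 2 (dpoly s) 1) dpoly2E.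
rewrite /dpoly derivB !derivMn derivXn -[1]/(1%:P) derivC polyC1 /=.
by ring.
Qed.

Lemma dpoly4E (R : realType) (s : nat) :
  iter 4 (dpoly s) 1 =
  (1 - 'X^2) * (1 *+ (3 * s * s + 2 * s) - 'X^2 *+ (3 * (s * s.+1 * s.+2))) -
  (1 *+ s) * ('X^2 *+ (3 * s * s + 2 * s) - 'X^4 *+ (s * s.+1 * s.+2)) :> {poly R}.
Proof.
rewrite [LHS]/= -[dpoly s (dpoly s (dpoly s 1))]/(iter 3 (dpoly s) 1) dpoly3E.
rewrite /dpoly derivB !derivMn derivXn derivX /=.
by ring.
Qed.

Lemma sqr_norm_le1 (R : realType) (x : R) : `|x| <= 1 -> 0 <= x ^+ 2 <= 1.
Proof.
by move=> x1; rewrite sqr_ge0 -(real_normK (num_real x)) exprn_ile1.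
Qed.

Lemma dpoly2_le (R : realType) (s : nat) (x : R) : (s == 3%N) || (s == 6%N) ->
  `|x| <= 1 -> `|(iter 2 (dpoly s) 1).[x]| <= s%:R ^+ 2.
Proof.
move=> hs /sqr_norm_le1 /andP[u0 u1]; rewrite dpoly2E !(hornerE, hornerMn, hornerXn).
by case/orP: hs => /eqP ->; apply/ler_normlP; split; lra.
Qed.

Lemma dpoly4_le (R : realType) (s : nat) (x : R) : (s == 3%N) || (s == 6%N) ->
  `|x| <= 1 -> `|(iter 4 (dpoly s) 1).[x]| <= s%:R ^+ 4.
Proof.
move=> hs /sqr_norm_le1 /andP[u0 u1]; rewrite dpoly4E !(hornerE, hornerMn, hornerXn).
have -> : x ^+ 4 = x ^+ 2 * x ^+ 2 by ring.
move: (x ^+ 2) u0 u1 => u u0 u1.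
(* With [u = w^2] the polynomial is quadratic and convex on [0,1], and [s^4] is its value at
   [u = 1]; this product gives the upper bound. *)
have uu : 0 <= u * (1 - u) by rewrite mulr_ge0// subr_ge0.
case/orP: hs => /eqP ->; set e := (X in `|X|).
  have -> : e = 33 - 312 * u + 360 * u ^+ 2 by rewrite /e /=; ring.
  (* [13/30] is the vertex of the parabola, which gives the lower bound; [11/36] plays this part for
     [s = 6]. *)
  have := sqr_ge0 (u - 13 / 30).
  by move=> h; apply/ler_normlP; split; nra.
have -> : e = 120 - 1848 * u + 3024 * u ^+ 2 by rewrite /e /=; ring.
have := sqr_ge0 (u - 11 / 36).
by move=> h; apply/ler_normlP; split; nra.
Qed.

Lemma dpoly1_odd (R : realType) (s : nat) (x : R) :
  (dpoly s 1).[- x] = - (dpoly s 1).[x].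
Proof. by rewrite dpoly1E !(hornerE, hornerMn) mulNrn. Qed.

Lemma dpoly3_odd (R : realType) (s : nat) (x : R) :
  (iter 3 (dpoly s) 1).[- x] = - (iter 3 (dpoly s) 1).[x].
Proof. by rewrite dpoly3E !(hornerE, hornerMn, hornerXn); ring. Qed.

Lemma zsum_ge1 (R : realType) (s : nat) : (2 <= s)%N -> 1 <= zsum s :> R.
Proof.
move=> s2; apply: le_trans (zsum_ge R 1 s2).
by rewrite /zpart big_ord1 expr1n invr1.
Qed.

(** Positivity is required only in the interior, so that an interval may start at 0, where the
    derivatives considered vanish. *)
Lemma deriv_pos_lt (R : realType) (f f1 : R -> R) (a b : R) : a < b ->
  (forall x, a <= x <= b -> is_derive x 1 f (f1 x)) ->
  (forall x, a < x < b -> 0 < f1 x) -> f a < f b.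
Proof.
move=> ab fE f1p.
have cf : {within `[a, b], continuous f}.
  apply: derivable_within_continuous => z; rewrite in_itv/= => /fE.
  by case.
have fE' (x : R) : x \in `]a, b[%R -> is_derive x 1 f (f1 x).
  by rewrite in_itv/= => /andP[ax xb]; apply: fE; rewrite !ltW.
have [c cab E] := MVT ab fE' cf.
rewrite -subr_gt0 E mulr_gt0 ?subr_gt0//.
by apply: f1p; rewrite in_itv/= in cab.
Qed.

Lemma expR_sub_ge (R : realType) (a : R) : 0 <= a -> 2 * a <= expR a - expR (- a).
Proof.
rewrite le_eqVlt => /orP[/eqP <-|a0]; first by rewrite oppr0 mulr0 subrr.
rewrite -subr_ge0.
pose f (x : R) := expR x - expR (- x) - 2 * x.
pose f1 (x : R) := expR x + expR (- x) - 2.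
have fE (x : R) : is_derive x 1 f (f1 x).
  apply: (is_derive_congr (is_deriveB (is_deriveB (is_derive_expR x)
    (is_derive_expRN x)) (is_deriveZ 2 (is_derive_id x 1)))) => //.
  by rewrite /f1 /GRing.scale/= opprK mulr1.
have f1p (x : R) : 0 < x -> 0 < f1 x.
  move=> x0; have e1 : 1 < expR x by rewrite expR_gt1.
  rewrite /f1 expRN; set e := expR x in e1 *.
  have e0 : 0 < e by apply: lt_trans e1.
  (* The derivative [2 cosh x - 2] is a square divided by [e^x]. *)
  have -> : e + e^-1 - 2 = (e - 1) ^+ 2 / e by field; rewrite gt_eqF.
  by rewrite divr_gt0// exprn_gt0// subr_gt0.
have : f 0 < f a.
  by apply: (deriv_pos_lt a0) => // x /andP[x0 _]; exact: f1p.
by rewrite {1}/f oppr0 expR0 mulr0 subrr subr0 => /ltW.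
Qed.

Lemma ef_odd0 (R : realType) (s k : nat) : (2 <= s)%N -> (k == 1%N) || (k == 3%N) ->
  ef s k (0 : R) = 0.
Proof.
move=> s2 hk; rewrite /ef mulr0 oppr0 expR0.
rewrite phi_odd0// ?mulr0 ?addr0; last first.
  by case/orP: hk => /eqP -> x; [exact: dpoly1_odd|exact: dpoly3_odd].
have -> : (-1) ^+ k = -1 :> R by case/orP: hk => /eqP ->; ring.
by ring.
Qed.

(** The lattice sum is at most [4 (s^(k+1) / 2^s) t], and [2 s t <= 2 sinh(s t)]. Thus each odd
    derivative used is a multiple of [sinh(s t)] up to a controlled relative error. *)
Lemma ef_odd_bound (R : realType) (s k : nat) (t : R) : (s == 3%N) || (s == 6%N) ->
  (k == 1%N) || (k == 3%N) -> 0 <= t ->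
  `|ef s k t - 2 * zsum (2 * s) * s%:R ^+ k * (expR (s%:R * t) - expR (- (s%:R * t)))|
    <= 8 * (s%:R ^+ k / 2 ^+ s) * (expR (s%:R * t) - expR (- (s%:R * t))).
Proof.
move=> hs hk t0.
have s2 : (2 <= s)%N by case/orP: hs => /eqP ->.
have s0 : 0 < s%:R :> R by rewrite ltr0n (leq_trans _ s2).
have E : (-1) ^+ k = -1 :> R by case/orP: hk => /eqP ->; ring.
rewrite /ef E mulN1r addrAC subrr add0r normrM ger0_norm//.
have h : `|phi s (iter k (dpoly s) 1) t| <= 4 * (s%:R ^+ k.+1 / 2 ^+ s) * t.
  rewrite -{2}(ger0_norm t0); apply: phi_odd_le => // [x|x x1].
    by case/orP: hk => /eqP ->; [exact: dpoly1_odd|exact: dpoly3_odd].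
  by case/orP: hk => /eqP ->; [exact: dpoly2_le|exact: dpoly4_le].
have e : 2 * (s%:R * t) <= expR (s%:R * t) - expR (- (s%:R * t)).
  by apply: expR_sub_ge; rewrite mulr_ge0// ltW.
apply: (@le_trans _ _ (8 * (s%:R ^+ k / 2 ^+ s) * (2 * (s%:R * t)))); last first.
  by rewrite ler_wpM2l// mulr_ge0// divr_ge0// exprn_ge0// ltW.
apply: (@le_trans _ _ (4 * (4 * (s%:R ^+ k.+1 / 2 ^+ s) * t))).
  by rewrite ler_wpM2l.
by rewrite le_eqVlt; apply/orP; left; apply/eqP; rewrite exprS; ring.
Qed.

(** The numerator of [(F'/G')'], where F is [ef 6 0] and G is [ef 3 0]. *)
Definition wronskian {R : realType} (t : R) : R :=
  ef 6 2 t * ef 3 1 t - ef 6 1 t * ef 3 2 t.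

Lemma ef31_gt0 (R : realType) (t : R) : 0 < t -> 0 < ef 3 1 t.
Proof.
move=> t0; have := @ef_odd_bound R 3 1 t isT isT (ltW t0).
have := @zsum_ge1 R 6 isT; rewrite -[(2 * 3)%N]/6%N.
have : 2 * (3 * t) <= expR (3 * t) - expR (- (3 * t)).
  by apply: expR_sub_ge; rewrite mulr_ge0// ltW.
rewrite expr1; set S := _ - expR _; set z := zsum 6; set G := ef _ _ _.
by move=> hS hz /ler_normlP[h1 h2]; nra.
Qed.

Lemma wronskian_deriv_gt0 (R : realType) (t : R) : 0 < t ->
  0 < ef 6 3 t * ef 3 1 t - ef 6 1 t * ef 3 3 t.
Proof.
move=> t0.
have t0' := ltW t0.
have /ler_normlP[a1 a2] := @ef_odd_bound R 6 3 t isT isT t0'.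
have /ler_normlP[b1 b2] := @ef_odd_bound R 6 1 t isT isT t0'.
have /ler_normlP[c1 c2] := @ef_odd_bound R 3 3 t isT isT t0'.
have /ler_normlP[d1 d2] := @ef_odd_bound R 3 1 t isT isT t0'.
have := @zsum_ge1 R 6 isT; have := @zsum_ge1 R 12 isT.
have : 2 * (3 * t) <= expR (3 * t) - expR (- (3 * t)).
  by apply: expR_sub_ge; rewrite mulr_ge0.
have : 2 * (6 * t) <= expR (6 * t) - expR (- (6 * t)).
  by apply: expR_sub_ge; rewrite mulr_ge0.
move: a1 a2 b1 b2 c1 c2 d1 d2; rewrite -[(2 * 3)%N]/6%N -[(2 * 6)%N]/12%N.
set S3 := expR (3 * t) - _; set S6 := expR (6 * t) - _; set z := zsum 6; set w := zsum 12.
set F1 := ef 6 1 t; set F3 := ef 6 3 t; set G1 := ef 3 1 t; set G3 := ef 3 3 t.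
clearbody S3 S6 z w F1 F3 G1 G3.
move=> a1 a2 b1 b2 c1 c2 d1 d2 hS6 hS3 hw hz.
have S60 : 0 < S6 by lra.
have S30 : 0 < S3 by lra.
(* Each main coefficient is [2 s^k] times a zeta value, and each error coefficient is [8 s^k / 2^s]:
   27, 3/4, 27 and 3 in the four bounds. *)
have A : (432 * w - 27) * S6 <= F3 by lra.
have B : F1 <= (12 * w + 3 / 4) * S6 by lra.
have C : G3 <= (54 * z + 27) * S3 by lra.
have D : (6 * z - 3) * S3 <= G1 by lra.
have AD : (432 * w - 27) * S6 * ((6 * z - 3) * S3) <= F3 * G1.
  have p6 : 0 <= 432 * w - 27 by lra.
  have p3 : 0 <= 6 * z - 3 by lra.
  exact: (ler_pM (mulr_ge0 p6 (ltW S60)) (mulr_ge0 p3 (ltW S30)) A D).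
clear a1 a2 b2 c2 d1 d2 hS3 hS6.
have C0 : 0 <= G3 by nra.
have B0 : 0 <= F1 by nra.
have BC : F1 * G3 <= (12 * w + 3 / 4) * S6 * ((54 * z + 27) * S3).
  exact: (ler_pM B0 C0 B C).
rewrite subr_gt0; apply: (le_lt_trans BC); apply: lt_le_trans AD.
have -> : (12 * w + 3 / 4) * S6 * ((54 * z + 27) * S3) =
  ((12 * w + 3 / 4) * (54 * z + 27)) * (S6 * S3) by ring.
have -> : (432 * w - 27) * S6 * ((6 * z - 3) * S3) =
  ((432 * w - 27) * (6 * z - 3)) * (S6 * S3) by ring.
rewrite ltr_pM2r ?mulr_gt0//.
(* The worst case is [w = z = 1], where the coefficients are 1032.75 and 1215. *)
by nra.
Qed.

Lemma is_derive_wronskian (R : realType) (t : R) :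
  is_derive t 1 wronskian (ef 6 3 t * ef 3 1 t - ef 6 1 t * ef 3 3 t).
Proof.
have d s k : (2 <= s)%N -> is_derive t 1 (ef s k) (ef s k.+1 t).
  by move=> s2; exact: is_derive_ef.
apply: (is_derive_congr (is_deriveB (is_deriveM (d 6 2 isT) (d 3 1 isT))
  (is_deriveM (d 6 1 isT) (d 3 2 isT)))) => //.
by rewrite /GRing.scale/=; ring.
Qed.

Lemma wronskian_gt0 (R : realType) (t : R) : 0 < t -> 0 < wronskian t.
Proof.
move=> t0; have <- : wronskian 0 = 0 :> R.
  by rewrite /wronskian (@ef_odd0 R 6 1)// (@ef_odd0 R 3 1)//; ring.
apply: (@deriv_pos_lt R wronskian
  (fun t => ef 6 3 t * ef 3 1 t - ef 6 1 t * ef 3 3 t) 0 t t0).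
  by move=> x _; exact: is_derive_wronskian.
by move=> x /andP[x0 _]; exact: wronskian_deriv_gt0.
Qed.

(** * The quotient of the derivatives and the minimizer *)

(** Chain rule through [t = ln x]; the factor [1/x] will cancel in the quotient. *)
Lemma is_derive_zeta_iy (R : realType) (s : nat) (x : R) : (2 <= s)%N -> 0 < x ->
  is_derive x 1 (zeta_iy s%:R) (ef s 1 (ln x) * x^-1).
Proof.
move=> s2 x0.
have h : is_derive x 1 (ef s 0 \o @ln R) (ef s 1 (ln x) * x^-1).
  by apply: is_derive1_comp; [exact: is_derive_ef|exact: is_derive1_ln].
apply: near_eq_is_derive h; near=> y.
have y0 : 0 < y by near: y; exact: lt_nbhsr.
by rewrite /= -zeta_iy_ef// lnK.
Unshelve. all: by end_near.
Qed.

Definition rho {R : realType} (t : R) : R := ef 6 1 t / ef 3 1 t.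

(** The value of [b_a]. It is a separate constant because [rho 0] is 0/0, which evaluates to 0. *)
Definition rho0 {R : realType} : R := ef 6 2 0 / ef 3 2 0.

(** The exponential part is [36 xi(6) >= 36], while the lattice part is at most 18 in absolute
    value. *)
Lemma ef32_gt0 (R : realType) : 0 < ef 3 2 (0 : R).
Proof.
have := @phi_norm_le R 3 (iter 2 (dpoly 3) 1) (3 ^+ 2) 0 isT (fun x => @dpoly2_le R 3 x isT).
have := @zsum_ge1 R 6 isT.
rewrite /ef mulr0 oppr0 expR0 -[(2 * 3)%N]/6%N.
move: (phi _ _ _) (zsum _) => p z hz /ler_normlP[h1 h2].
have -> : (-1) ^+ 2 = 1 :> R by ring.
lra.
Qed.

Lemma cvg_difference_quotient0 (R : realType) (f : R -> R) (l : R) :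
  is_derive (0 : R) 1 f l -> f 0 = 0 -> (f t / t) @[t --> 0^'] --> l.
Proof.
move=> [df <-] f0.
apply: cvg_trans df; apply: near_eq_cvg; near=> t.
by rewrite /= f0 subr0 addr0 /GRing.scale/= mulr1 mulrC.
Unshelve. all: by end_near.
Qed.

(** L'Hopital's rule: after division by t, numerator and denominator are difference quotients at
    0. *)
Lemma rho_cvg0 (R : realType) : rho t @[t --> (0 : R)^'] --> (rho0 : R).
Proof.
have h6 := cvg_difference_quotient0 (@is_derive_ef R 6 1 0 isT) (@ef_odd0 R 6 1 isT isT).
have h3 := cvg_difference_quotient0 (@is_derive_ef R 3 1 0 isT) (@ef_odd0 R 3 1 isT isT).
have h : (ef 6 1 t / t) / (ef 3 1 t / t) @[t --> (0 : R)^'] --> (rho0 : R).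
  by apply: cvgM => //; apply: cvgV => //; rewrite gt_eqF// ef32_gt0.
apply: cvg_trans h; apply: near_eq_cvg; near=> t.
have t0 : t != 0 by near: t; exact: nbhs_dnbhs_neq.
by rewrite /rho invfM invrK mulrACA mulVf// mulr1.
Unshelve. all: by end_near.
Qed.

Lemma is_derive_rho (R : realType) (t : R) : 0 < t ->
  is_derive t 1 rho (wronskian t / ef 3 1 t ^+ 2).
Proof.
move=> t0; have g0 : ef 3 1 t != 0 by rewrite gt_eqF// ef31_gt0.
have d s k : (2 <= s)%N -> is_derive t 1 (ef s k) (ef s k.+1 t).
  by move=> s2; exact: is_derive_ef.
apply: (is_derive_congr (is_deriveM (d 6 1 isT) (is_deriveV g0 (d 3 1 isT)))) => //.
rewrite /GRing.scale/= /wronskian.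
by move: (ef 6 2 t) (ef 6 1 t) (ef 3 2 t) (ef 3 1 t) g0 => a b c e g0; field.
Qed.

Lemma rho_deriv_gt0 (R : realType) (t : R) : 0 < t -> 0 < wronskian t / ef 3 1 t ^+ 2.
Proof. by move=> t0; rewrite divr_gt0 ?exprn_gt0 ?ef31_gt0 ?wronskian_gt0. Qed.

Lemma rho_lt (R : realType) (x y : R) : 0 < x -> x < y -> rho x < rho y.
Proof.
move=> x0 xy; apply: (@deriv_pos_lt R rho (fun t => wronskian t / ef 3 1 t ^+ 2) x y xy).
  by move=> z /andP[xz _]; apply: is_derive_rho; exact: lt_le_trans xz.
by move=> z /andP[xz _]; apply: rho_deriv_gt0; exact: lt_trans xz.
Qed.

Lemma continuous_rho (R : realType) (t : R) : 0 < t -> {for t, continuous rho}.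
Proof.
move=> /is_derive_rho [h _].
by apply/differentiable_continuous; rewrite -derivable1_diffP.
Qed.

Lemma rho_gt (R : realType) (t : R) : 0 < t -> rho0 < rho t.
Proof.
move=> t0; have t2 : 0 < t / 2 by rewrite divr_gt0.
(* Passing through [t / 2] turns the weak inequality obtained from the limit at 0 into a strict
   one. *)
apply: (@le_lt_trans _ _ (rho (t / 2))); last by apply: rho_lt => //; lra.
rewrite leNgt; apply/negP => hlt.
have := @rho_cvg0 R; move/cvgr_gt => /(_ _ hlt) [d /= d0 hd].
pose u := Num.min (d / 2) (t / 4).
have u0 : 0 < u by rewrite /u lt_min !divr_gt0.
have ut : u < t / 2 by apply: (@le_lt_trans _ _ (t / 4)); [rewrite ge_min lexx orbT|lra].
have ud : u < d by apply: (@le_lt_trans _ _ (d / 2)); [rewrite ge_min lexx|lra].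
have := hd u; rewrite /= sub0r normrN gtr0_norm// => /(_ ud).
rewrite gt_eqF// => /(_ isT); apply/negP; rewrite -leNgt ltW//.
exact: rho_lt.
Qed.

(** * Growth of F'/G' at infinity, and its inverse *)

Lemma cvg_pinfty_expR (R : realType) (f : R -> R) (l K : R) :
  (forall t, 0 < t -> `|f t - l| <= K * expR (- t)) -> f t @[t --> +oo] --> l.
Proof.
move=> H.
have h : K * expR (- t) @[t --> +oo%R] --> K * 0.
  by apply: cvgM; [exact: cvg_cst|exact: cvgr_expR].
rewrite mulr0 in h; apply/cvgrPdist_le => e e0.
move/cvgrPdist_le : h => /(_ _ e0) h; near=> t.
have t0 : 0 < t by near: t; exact: (nbhs_pinfty_gt (num_real _)).
rewrite distrC; apply: le_trans (H t t0) _.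
apply: le_trans (ler_norm _) _; rewrite -normrN -sub0r.
by near: t.
Unshelve. all: by end_near.
Qed.

(** After scaling, what remains is [Z e^(-2 s t)] and a bounded lattice sum times [e^(-s t)]; both
    are at most a constant times [e^(-t)]. *)
Lemma ef1_asymptotic (R : realType) (s : nat) : (2 <= s)%N ->
  ef s 1 t * expR (- (s%:R * t)) @[t --> +oo] --> (2 * zsum (2 * s) * s%:R : R).
Proof.
move=> s2.
have [C hC] := poly_bounded (iter 1 (dpoly s) (1 : {poly R})).
pose Z : R := 2 * zsum (2 * s) * s%:R.
have Z0 : 0 <= Z.
  rewrite !mulr_ge0//; apply: le_trans ler01 (zsum_ge1 _ _).
  by rewrite (leq_trans s2)// leq_pmull.
pose P : R := 4 * (4 * (C / 2 ^+ s)).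
apply: (@cvg_pinfty_expR _ _ _ (Z + P)) => t t0.
have st : t <= s%:R * t by rewrite ler_peMl ?(ltW t0)// ler1n (leq_trans _ s2).
have e1 : expR (- (s%:R * t)) <= expR (- t) by rewrite ler_expR lerN2.
have e2 : expR (- (s%:R * t)) * expR (- (s%:R * t)) <= expR (- t).
  rewrite -expRD ler_expR; lra.
have eV : expR (s%:R * t) * expR (- (s%:R * t)) = 1 by rewrite expRN divff ?gt_eqF ?expR_gt0.
have /ler_normlP[p1 p2] := phi_norm_le t s2 hC.
have E0 : 0 <= expR (- (s%:R * t)) by exact: expR_ge0.
rewrite /ef expr1 -/Z; set p := phi _ _ _ in p1 p2 *.
set E := expR (- (s%:R * t)) in e1 e2 eV E0 *.
have -> : (Z * (expR (s%:R * t) + -1 ^+ 1 * E) + 4 * p) * E - Z =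
    Z * (expR (s%:R * t) * E - 1) - Z * (E * E) + 4 * p * E by ring.
rewrite eV subrr mulr0 sub0r [leRHS]mulrDl.
apply: le_trans (ler_normD _ _) _; apply: lerD.
  have ZE := mulr_ge0 Z0 (mulr_ge0 E0 E0).
  by rewrite normrN (ger0_norm ZE); exact: ler_wpM2l.
rewrite normrM (ger0_norm E0); apply: ler_pM => //.
by rewrite /P normrM ger0_norm// ler_wpM2l//; apply/ler_normlP; split.
Qed.

Lemma rho_asymptotic (R : realType) :
  rho t * expR (- (3 * t)) @[t --> +oo] --> (2 * zsum 12 / zsum 6 : R).
Proof.
have h6 := @ef1_asymptotic R 6 isT; have h3 := @ef1_asymptotic R 3 isT.
have z1 := @zsum_ge1 R 6 isT.
have nz : (2 * zsum (2 * 3) * 3 : R) != 0.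
  by rewrite gt_eqF// -[(2 * 3)%N]/6%N; lra.
have h : ef 6 1 t * expR (- (6 * t)) / (ef 3 1 t * expR (- (3 * t))) @[t --> +oo%R]
    --> (2 * zsum (2 * 6) * 6 / (2 * zsum (2 * 3) * 3) : R).
  by apply: cvgM => //; exact: cvgV.
have -> : (2 * zsum 12 / zsum 6 : R) =
    2 * zsum (2 * 6) * 6 / (2 * zsum (2 * 3) * 3).
  rewrite -[(2 * 6)%N]/12%N -[(2 * 3)%N]/6%N; field.
  by rewrite gt_eqF//; lra.
apply: cvg_trans h; apply: near_eq_cvg; near=> t.
rewrite /rho /= invfM -expRN opprK.
rewrite mulrACA -expRD -[RHS]mulrA [RHS]mulrA.
by congr (_ * expR _); ring.
Unshelve. all: by end_near.
Qed.

Lemma rho_unbounded (R : realType) (b : R) : \forall t \near +oo, b < rho t.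
Proof.
(* Half the limit of [rho t * expR (- (3 * t))], so eventually [rho t > c e^(3t) > c t]. *)
pose c : R := zsum 12 / zsum 6.
have z1 := @zsum_ge1 R 6 isT; have z2 := @zsum_ge1 R 12 isT.
have c0 : 0 < c by apply: divr_gt0; lra.
have cc : c < 2 * zsum 12 / zsum 6 by rewrite -mulrA -/c; lra.
have := @rho_asymptotic R; move/cvgr_gt => /(_ _ cc) h; near=> t.
have t0 : 0 < t by near: t; exact: (nbhs_pinfty_gt (num_real _)).
have tb : b / c < t by near: t; exact: (nbhs_pinfty_gt (num_real _)).
have hc : c < rho t * expR (- (3 * t)) by near: t.
have e3 : t < expR (3 * t).
  by have := expR_ge1Dx (3 * t); lra.
rewrite ltr_pdivrMr// in tb; apply: lt_trans tb _.
rewrite expRN ltr_pdivlMr ?expR_gt0// in hc; apply: lt_trans hc.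
by rewrite mulrC ltr_pM2l.
Unshelve. all: by end_near.
Qed.

Lemma rho_surj (R : realType) (b : R) : rho0 < b -> exists2 t, 0 < t & rho t = b.
Proof.
move=> hb.
have [u u0 ub] : exists2 u : R, 0 < u & rho u < b.
  have := @rho_cvg0 R; move/cvgr_lt => /(_ _ hb) [d /= d0 hd].
  exists (d / 2); first by rewrite divr_gt0.
  apply: hd; last by rewrite gt_eqF// divr_gt0.
  by rewrite /= sub0r normrN gtr0_norm ?divr_gt0//; lra.
have [T [uT bT]] : exists T : R, u < T /\ b < rho T.
  near (pinfty_nbhs R) => T; exists T; split; near: T; first exact: (nbhs_pinfty_gt (num_real _)).
  exact: rho_unbounded.
have cf : {within `[u, T], continuous rho}.
  apply: derivable_within_continuous => z; rewrite in_itv/= => /andP[uz _].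
  by have [] := is_derive_rho (lt_le_trans u0 uz).
have /(IVT (ltW uT) cf) : Num.min (rho u) (rho T) <= b <= Num.max (rho u) (rho T).
  by rewrite ge_min le_max (ltW ub) (ltW bT) orbT.
move=> [t]; rewrite in_itv/= => /andP[ut _] tb; exists t => //.
exact: lt_le_trans ut.
Unshelve. all: by end_near.
Qed.

Lemma rho_inj (R : realType) (x y : R) : 0 < x -> 0 < y -> rho x = rho y -> x = y.
Proof.
move=> x0 y0 E; have [xy|yx|//] := ltgtP x y.
  by have := rho_lt x0 xy; rewrite E ltxx.
by have := rho_lt y0 yx; rewrite E ltxx.
Qed.

Lemma cubeK (R : realType) (x : R) : 0 <= x -> (x ^+ 3) `^ 3^-1 = x.
Proof.
by move=> x0; rewrite -powR_mulrn// -powRrM divff ?powRr1// pnatr_eq0.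
Qed.

Lemma cbrtK (R : realType) (x : R) : 0 <= x -> (x `^ 3^-1) ^+ 3 = x.
Proof.
move=> x0; rewrite -powR_mulrn ?powR_ge0// -powRrM mulVf ?powRr1// pnatr_eq0.
Qed.

Lemma zeta_ratio_cvg (R : realType) :
  (derive1 (zeta_iy 6) x / derive1 (zeta_iy 3) x) @[x --> (1 : R)^'] --> (rho0 : R).
Proof.
have h : rho (ln x) @[x --> (1 : R)^'] --> (rho0 : R).
  (* The limit of [rho] is punctured, so [ln x] must also avoid 0 for [x] near 1 and different from
     1. *)
  have c : ln x @[x --> (1 : R)^'] --> (0 : R)^'.
    move=> A /= hA.
    have hA' : \forall t \near (0 : R), t != 0 -> A t by exact: hA.
    have lc : ln x @[x --> (1 : R)] --> (0 : R).
      have l : ln x @[x --> (1 : R)] --> ln (1 : R) by exact: continuous_ln.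
      by rewrite ln1 in l.
    have p1 : \forall x \near (1 : R), 0 < x by apply: lt_nbhsr.
    have := lc _ hA' => h1.
    rewrite /nbhs/= /dnbhs/within/=; near=> x => x1; have h2 : ln x != 0 -> A (ln x).
      by near: x.
    have x0 : 0 < x by near: x.
    by apply: h2; rewrite ln_eq0.
  exact: (cvg_comp _ _ c (@rho_cvg0 R)).
apply: cvg_trans h; apply: near_eq_cvg; near=> x.
have x0 : 0 < x by near: x; apply: nbhs_dnbhs; exact: lt_nbhsr.
have e6 := is_derive_zeta_iy (s := 6) isT x0.
have e3 := is_derive_zeta_iy (s := 3) isT x0.
rewrite !derive1E !derive_val /rho invfM invrK mulrACA mulVf ?mulr1//.
by rewrite gt_eqF.
Unshelve. all: by end_near.
Qed.

(** * Minimization of F - b G on the half-line *)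

Lemma Wb_expR (R : realType) (b t : R) : Wb b (expR t) = ef 6 0 t - b * ef 3 0 t.
Proof. by rewrite /Wb !zeta_iy_ef. Qed.

Lemma is_derive_Wb_expR (R : realType) (b t : R) :
  is_derive t 1 (fun t => Wb b (expR t)) (ef 6 1 t - b * ef 3 1 t).
Proof.
apply: (is_derive_congr (is_deriveB (@is_derive_ef R 6 0 t isT)
  (is_deriveZ b (@is_derive_ef R 3 0 t isT)))) => //.
by apply/funext => x; rewrite Wb_expR.
Qed.

Lemma Wb_derivE (R : realType) (b t : R) : 0 < t ->
  ef 6 1 t - b * ef 3 1 t = (rho t - b) * ef 3 1 t.
Proof. by move=> t0; rewrite /rho mulrBl divfK// gt_eqF// ef31_gt0. Qed.

Lemma Wb_incr (R : realType) (b x y : R) : 0 <= x -> x < y ->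
  (forall t, x < t -> b < rho t) -> Wb b (expR x) < Wb b (expR y).
Proof.
move=> x0 xy H; apply: (@deriv_pos_lt R (fun t => Wb b (expR t))
  (fun t => ef 6 1 t - b * ef 3 1 t) x y xy) => [t _|t /andP[xt _]].
  exact: is_derive_Wb_expR.
have t0 := le_lt_trans x0 xt.
by rewrite Wb_derivE// mulr_gt0 ?ef31_gt0// subr_gt0 H.
Qed.

Lemma Wb_decr (R : realType) (b x y : R) : 0 <= x -> x < y ->
  (forall t, 0 < t -> t < y -> rho t < b) -> Wb b (expR y) < Wb b (expR x).
Proof.
move=> x0 xy H; rewrite -ltrN2.
apply: (@deriv_pos_lt R (fun t => - Wb b (expR t))
  (fun t => - (ef 6 1 t - b * ef 3 1 t)) x y xy) => [t _|t /andP[xt ty]].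
  apply: (is_derive_congr (is_deriveN (is_derive_Wb_expR b t))) => //.
have t0 := le_lt_trans x0 xt.
by rewrite Wb_derivE// -mulNr mulr_gt0 ?ef31_gt0// opprB subr_gt0 H.
Qed.

Lemma Gamma_a_expR (R : realType) (y : R) : Gamma_a_y y ->
  exists2 t, 0 <= t & y = expR t.
Proof.
rewrite /Gamma_a_y/= => y1; exists (ln y); first exact: ln_ge0.
by rewrite lnK// posrE (lt_le_trans ltr01).
Qed.

Lemma Wb_min_at_1 (R : realType) (b y : R) : b <= rho0 -> Gamma_a_y y ->
  Wb b 1 <= Wb b y.
Proof.
move=> hb /Gamma_a_expR[t t0 ->]; rewrite -expR0.
move: t0; rewrite le_eqVlt => /orP[/eqP <-//|t0].
by apply/ltW/Wb_incr => // u u0; exact: le_lt_trans (rho_gt u0).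
Qed.

Lemma Wb_lt_min (R : realType) (b t u : R) : 0 < t -> rho t = b -> 0 <= u -> u != t ->
  Wb b (expR t) < Wb b (expR u).
Proof.
move=> t0 tb u0; case: (ltgtP u t) => // [ut|tu] _.
  by apply: Wb_decr => // v v0 vt; rewrite -tb; exact: rho_lt.
by apply: Wb_incr => [|//|v tv]; [exact: ltW|rewrite -tb; exact: rho_lt].
Qed.

(** * Derivative and asymptotics of the minimizer *)

Lemma is_derive_rho_inv (R : realType) (tau : R -> R) (b : R) :
  (forall c, rho0 < c -> 0 < tau c /\ rho (tau c) = c) -> rho0 < b ->
  is_derive b 1 tau (wronskian (tau b) / ef 3 1 (tau b) ^+ 2)^-1.
Proof.
move=> tauP hb; have [t0 tb] := tauP b hb.
rewrite -{1}tb; apply: is_derive_inverse.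
- near=> x; have x0 : 0 < x by near: x; exact: lt_nbhsr.
  (* [tau] is given as a right inverse; injectivity of [rho] makes it a left inverse as well. *)
  by have [r0 r1] := tauP _ (rho_gt x0); exact: rho_inj.
- near=> x; have x0 : 0 < x by near: x; exact: lt_nbhsr.
  exact: continuous_rho.
- exact: is_derive_rho.
- by rewrite gt_eqF// rho_deriv_gt0.
Unshelve. all: by end_near.
Qed.

Lemma is_derive_expR_rho_inv (R : realType) (tau : R -> R) (b : R) :
  (forall c, rho0 < c -> 0 < tau c /\ rho (tau c) = c) -> rho0 < b ->
  derivable (expR \o tau) b 1 /\ 0 < derive1 (expR \o tau) b.
Proof.
move=> tauP hb; have h := is_derive_rho_inv tauP hb.
have [d e] := is_derive1_comp (is_derive_expR (tau b)) h.
split => //; rewrite derive1E e mulr_gt0 ?expR_gt0// invr_gt0 rho_deriv_gt0//.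
by have [] := tauP b hb.
Qed.

Lemma rho_inv_asymptotic (R : realType) (tau : R -> R) :
  (forall c, rho0 < c -> 0 < tau c /\ rho (tau c) = c) ->
  expR (tau b) / ((zsum 6 / (2 * zsum 12) * b) `^ (3^-1)) @[b --> +oo%R] --> (1 : R).
Proof.
move=> tauP; pose c : R := zsum 6 / (2 * zsum 12).
have z1 := @zsum_ge1 R 6 isT; have z2 := @zsum_ge1 R 12 isT.
have c0 : 0 < c by apply: divr_gt0; lra.
have cE : c * (2 * zsum 12 / zsum 6) = 1 by rewrite /c; field; rewrite !gt_eqF//; lra.
(* At [t = tau b] this quantity is [e^(3 tau b) / (c b)], the cube of the quotient sought. *)
have hH : (c * (rho t * expR (- (3 * t))))^-1 @[t --> +oo%R] --> (1 : R).
  rewrite -[X in _ --> X]invr1; apply: cvgV; first exact: oner_neq0.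
  by rewrite -[X in _ --> X]cE; apply: cvgM; [exact: cvg_cst|exact: rho_asymptotic].
(* By monotonicity of [rho], [tau b] exceeds B as soon as b exceeds [rho B]. *)
have htau : tau b @[b --> +oo%R] --> +oo%R.
  apply/cvgryPgt => A; pose B := Num.max A 1.
  have B0 : 0 < B by rewrite lt_max ltr01 orbT.
  near=> b.
  have hb : rho B < b by near: b; exact: (nbhs_pinfty_gt (num_real _)).
  have [t0 tb] := tauP b (lt_trans (rho_gt B0) hb).
  apply: (@le_lt_trans _ _ B); first by rewrite le_max lexx.
  rewrite ltNge; apply/negP => tB; move: hb; rewrite -tb; apply/negP; rewrite -leNgt.
  by move: tB; rewrite le_eqVlt => /orP[/eqP ->//|tB]; apply/ltW/rho_lt.
have cc : (x : R) `^ 3^-1 @[x --> (1 : R)] --> (1 : R).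
  have [d _] := @is_derive1_powR R 3^-1 1 ltr01.
  have c1 : {for (1 : R), continuous (fun x : R => x `^ 3^-1)}.
    by apply/differentiable_continuous; rewrite -derivable1_diffP.
  have l : x `^ 3^-1 @[x --> (1 : R)] --> (1 : R) `^ 3^-1 := c1.
  by rewrite powR1 in l.
have h := cvg_comp _ _ (cvg_comp _ _ htau hH) cc.
apply: cvg_trans h; apply: near_eq_cvg; near=> b.
have hb : rho0 < b by near: b; exact: (nbhs_pinfty_gt (num_real _)).
have b0 : 0 < b by near: b; exact: (nbhs_pinfty_gt (num_real _)).
have [t0 tb] := tauP b hb.
rewrite /= tb -/c.
have cb : 0 < c * b by rewrite mulr_gt0.
have P0 : 0 < (c * b) `^ 3^-1 by rewrite powR_gt0.
rewrite -[RHS]cubeK; last by rewrite divr_ge0 ?expR_ge0// ltW.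
congr (_ `^ _); rewrite expr_div_n cbrtK ?(ltW cb)// -expRM_natl expRN.
by rewrite mulrA invfM invrK mulrC.
Unshelve. all: by end_near.
Qed.

(** * Numerical enclosure of b_a *)

(** As [q >= 1], the case [s = 3] suffices; there [2 (x^2 + y^2) >= (x + y)^2] and
    [(x^2 + y^2)^2 >= x^4]. The right side telescopes in j and leaves [2 / m^5] for a row. *)
Lemma inv_expn_le (R : realType) (s : nat) (i j : nat) : (3 <= s)%N ->
  (qf i j (0 : R) ^+ s)^-1 <= 2 * (i.+1%:R ^+ 4)^-1 * ((i.+1%:R + j.+1%:R) ^+ 2)^-1.
Proof.
move=> s3.
have q2 : 2 <= qf i j (0 : R).
  apply: le_trans (qf_ge _ _ _); rewrite ler_peMr//.
  by rewrite -natrM ler1n muln_gt0.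
have q0 := qf_gt0 i j (0 : R).
have x0 : 0 < i.+1%:R :> R by [].
have y0 : 0 < j.+1%:R :> R by [].
apply: (@le_trans _ _ (qf i j (0 : R) ^+ 3)^-1).
  by rewrite lef_pV2 ?posrE ?exprn_gt0// ler_weXn2l// (le_trans _ q2)// ler1n.
have E : qf i j (0 : R) = i.+1%:R ^+ 2 + j.+1%:R ^+ 2.
  by rewrite /qf oppr0 expR0 !mulr1.
rewrite E in q0 *; move: (i.+1%:R : R) (j.+1%:R : R) x0 y0 q0 => x y x0 y0 q0.
have d0 : 0 < x ^+ 4 * (x + y) ^+ 2 by rewrite mulr_gt0 ?exprn_gt0 ?addr_gt0.
rewrite -mulrA -invfM ler_pdivlMr// ler_pdivrMl ?exprn_gt0//.
rewrite -subr_ge0.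
have -> : (x ^+ 2 + y ^+ 2) ^+ 3 * 2 - x ^+ 4 * (x + y) ^+ 2 =
  x ^+ 4 * (x - y) ^+ 2 + 2 * (x ^+ 2 + y ^+ 2) * (2 * x ^+ 2 * y ^+ 2 + y ^+ 4) by ring.
have x4 : 0 <= x ^+ 4 by rewrite exprn_ge0// ltW.
have y4 : 0 <= y ^+ 4 by rewrite exprn_ge0// ltW.
have xy := mulr_ge0 (sqr_ge0 x) (sqr_ge0 y).
apply: addr_ge0; first exact: (mulr_ge0 x4 (sqr_ge0 _)).
by apply: mulr_ge0; lra.
Qed.

Lemma sum_inv_exp_tail (R : realType) (s N K : nat) : (2 <= s)%N -> (0 < N)%N ->
  \sum_(k < K) ((N + k).+1%:R ^+ s)^-1 <= (N%:R ^+ s.-1)^-1 :> R.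
Proof.
move=> s2 N0; have n0 : 0 < N%:R :> R by rewrite ltr0n.
apply: (@le_trans _ _ ((N%:R ^+ s.-2)^-1 * \sum_(k < K) ((N%:R + k.+1%:R) ^+ 2)^-1)).
  rewrite mulr_sumr; apply: ler_sum => k _.
  rewrite -natrD addnS -invfM lef_pV2 ?posrE ?mulr_gt0 ?exprn_gt0//.
  rewrite -[in leRHS](subnK s2) exprD ler_wpM2r ?exprn_ge0// -subn2 lerXn2r ?nnegrE//.
  by rewrite ler_nat ltnW// ltnS leq_addr.
apply: (@le_trans _ _ ((N%:R ^+ s.-2)^-1 * (N%:R)^-1)).
  by rewrite ler_wpM2l ?invr_ge0 ?exprn_ge0 ?(ltW n0)// sum_inv_sqr_le.
by rewrite -invfM -exprSr; case: s s2 => [|[|s]].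
Qed.

(** The rows beyond N contribute at most the sum of [2 / m^5], hence [2 / N^4]; by symmetry the same
    holds for the columns beyond N. *)
Lemma sq_sum_tail (R : realType) (s N K : nat) : (3 <= s)%N -> (0 < N)%N ->
  sq_sum (fun i j => (qf i j (0 : R) ^+ s)^-1) (N + K) <=
  sq_sum (fun i j => (qf i j (0 : R) ^+ s)^-1) N + 4 / N%:R ^+ 4.
Proof.
move=> s3 N0; pose v i j := (qf i j (0 : R) ^+ s)^-1; rewrite -/v.
have v0 i j : 0 <= v i j by rewrite invr_ge0 exprn_ge0// ltW// qf_gt0.
have vC i j : v i j = v j i by rewrite /v /qf oppr0 expR0 !mulr1 addrC.
have H : \sum_(k < K) \sum_(j < N + K) v (N + k)%N j <= 2 / N%:R ^+ 4.
  apply: (@le_trans _ _ (\sum_(k < K) 2 * ((N + k).+1%:R ^+ 5)^-1)).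
    apply: ler_sum => k _.
    apply: (@le_trans _ _ (\sum_(j < N + K) 2 * ((N + k).+1%:R ^+ 4)^-1 *
        (((N + k).+1%:R + j.+1%:R) ^+ 2)^-1)).
      by apply: ler_sum => j _; exact: inv_expn_le.
    have -> : 2 * ((N + k).+1%:R ^+ 5)^-1 =
        2 * ((N + k).+1%:R ^+ 4)^-1 * ((N + k).+1%:R)^-1 :> R.
      by rewrite -mulrA -invfM -exprSr.
    rewrite -mulr_sumr ler_wpM2l ?mulr_ge0 ?invr_ge0 ?exprn_ge0//.
    exact: sum_inv_sqr_le.
  by rewrite -mulr_sumr ler_wpM2l// (@sum_inv_exp_tail R 5).
have S : sq_sum v (N + K) = sq_sum v N + \sum_(i < N) \sum_(k < K) v i (N + k)%N +
    \sum_(k < K) \sum_(j < N + K) v (N + k)%N j.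
  rewrite /sq_sum big_split_ord/=; congr (_ + _).
  by rewrite -big_split/=; apply: eq_bigr => i _; rewrite big_split_ord.
rewrite S -addrA lerD2l.
have -> : 4 / N%:R ^+ 4 = 2 / N%:R ^+ 4 + 2 / N%:R ^+ 4 :> R by lra.
apply: lerD => //; apply: le_trans H.
rewrite exchange_big/=; apply: ler_sum => k _.
rewrite [leRHS]big_split_ord/= ler_wpDr ?sumr_ge0//.
by rewrite le_eqVlt; apply/orP; left; apply/eqP; apply: eq_bigr => i _; exact: vC.
Qed.

(** With [v = q^-s], the terms plus [a v], and [b v] minus the terms, are nonnegative. Their square
    sums increase, so the tail of [v] controls both errors. *)
Lemma phi_partial_bounds (R : realType) (s N : nat) (p : {poly R}) (a b : R) :
  (3 <= s)%N -> (0 < N)%N -> 0 <= a -> 0 <= b ->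
  (forall x, `|x| <= 1 -> - a <= p.[x] <= b) ->
  sq_sum (term s p 0) N - a * (4 / N%:R ^+ 4) <= phi s p 0 <=
  sq_sum (term s p 0) N + b * (4 / N%:R ^+ 4).
Proof.
move=> s3 N0 a0 b0 pab.
pose v i j := (qf i j (0 : R) ^+ s)^-1.
have v0 i j : 0 <= v i j by rewrite invr_ge0 exprn_ge0// ltW// qf_gt0.
have tle i j : - a * v i j <= term s p 0 i j <= b * v i j.
  have /andP[h1 h2] := pab _ (wf_norm i j (0 : R)).
  by rewrite /term mulrC [b * _]mulrC -/(v i j) !ler_wpM2l.
have inc1 : nondecreasing_seq (sq_sum (fun i j => term s p 0 i j + a * v i j)).
  by apply: nondecreasing_sq_sum => i j; have /andP[] := tle i j; lra.
have inc2 : nondecreasing_seq (sq_sum (fun i j => b * v i j + -1 * term s p 0 i j)).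
  by apply: nondecreasing_sq_sum => i j; have /andP[] := tle i j; lra.
have [C hC] := poly_bounded p.
have c : sq_sum (term s p 0) n @[n --> \oo] --> phi s p 0.
  by apply: dsum_cvg; apply: term_dominated hC; exact: leq_trans s3.
have bnd M : (N <= M)%N ->
    sq_sum (term s p 0) N - a * (4 / N%:R ^+ 4) <= sq_sum (term s p 0) M <=
    sq_sum (term s p 0) N + b * (4 / N%:R ^+ 4).
  move=> NM; have := @sq_sum_tail R s N (M - N) s3 N0; rewrite subnKC//= => T.
  have := inc1 _ _ NM; rewrite sq_sumD sq_sumZ/= => h1.
  have := inc2 _ _ NM; rewrite sq_sumD !sq_sumZ/= => h2.
  have aT := ler_wpM2l a0 T; have bT := ler_wpM2l b0 T.
  by apply/andP; split; lra.
have /cvgP cc := c.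
have nearN : \forall M \near \oo, (N <= M)%N by exact: nbhs_infty_ge.
apply/andP; split.
  by apply: limr_ge; [exact: cc|apply: filterS nearN => M /bnd/andP[]].
by apply: limr_le; [exact: cc|apply: filterS nearN => M /bnd/andP[]].
Qed.

Lemma zsum_partial_bounds (R : realType) (s N : nat) : (2 <= s)%N -> (0 < N)%N ->
  zpart s N <= (zsum s : R) <= zpart s N + (N%:R ^+ s.-1)^-1.
Proof.
move=> s2 N0; rewrite zsum_ge//=; apply: zsum_le => // n.
apply: le_trans (_ : zpart s (N + n) <= _).
  by apply: zsum_nondecreasing; exact: leq_addl.
by rewrite /zpart big_split_ord/= lerD2l sum_inv_exp_tail.
Qed.

(** * Fixed-point evaluation in integer arithmetic *)

Definition ZR {R : realType} (z : Z) : R := (int_of_Z z)%:~R.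

Lemma ZRD (R : realType) (a b : Z) : ZR (Z.add a b) = ZR a + ZR b :> R.
Proof. by rewrite /ZR -intrD -rmorphD. Qed.

Lemma ZRM (R : realType) (a b : Z) : ZR (Z.mul a b) = ZR a * ZR b :> R.
Proof. by rewrite /ZR -intrM -rmorphM. Qed.

Lemma ZRN (R : realType) (a : Z) : ZR (Z.opp a) = - ZR a :> R.
Proof. by rewrite /ZR -mulrNz -rmorphN. Qed.

Lemma ZR_nat (R : realType) (n : nat) : ZR (Z.of_nat n) = n%:R :> R.
Proof. by rewrite /ZR -[Z.of_nat n]/(Z_of_int (Posz n)) Z_of_intK. Qed.

Lemma ZR_xO (R : realType) (p : positive) : ZR (Zpos (xO p)) = 2 * ZR (Zpos p) :> R.
Proof. by rewrite -[Zpos (xO p)]/(Z.mul (Z.of_nat 2) (Zpos p)) ZRM ZR_nat. Qed.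

Lemma ZR_xI (R : realType) (p : positive) :
  ZR (Zpos (xI p)) = 2 * ZR (Zpos p) + 1 :> R.
Proof.
by rewrite -[Zpos (xI p)]/(Z.add (Z.mul (Z.of_nat 2) (Zpos p)) (Z.of_nat 1)) ZRD ZRM !ZR_nat.
Qed.

Lemma ZR_xH (R : realType) : ZR (Zpos xH) = 1 :> R.
Proof. by rewrite -[Zpos xH]/(Z.of_nat 1) ZR_nat. Qed.

Lemma ZR_le (R : realType) (a b : Z) : Z.leb a b -> ZR a <= ZR b :> R.
Proof.
move=> ab; rewrite -subr_ge0 -ZRN -ZRD.
have /Z2Nat.id <- : Z.le Z0 (Z.add b (Z.opp a)) by move/Z.leb_le: ab; lia.
by rewrite ZR_nat.
Qed.

Lemma ZR_div_bounds (R : realType) (a d : Z) : Z.ltb Z0 d ->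
  ZR (Z.div a d) <= (ZR a / ZR d : R) <= ZR (Z.div a d) + 1.
Proof.
move=> /Z.ltb_lt d0.
have dR : 0 < ZR d :> R.
  have : ZR (Z.of_nat 1) <= ZR d :> R by apply: ZR_le; apply/Z.leb_le; lia.
  by rewrite ZR_nat; exact: lt_le_trans.
rewrite ler_pdivlMr// ler_pdivrMr//.
have -> : ZR (Z.div a d) + 1 = ZR (Z.add (Z.div a d) (Z.of_nat 1)) :> R.
  by rewrite ZRD ZR_nat.
rewrite -!ZRM.
by apply/andP; split; apply: ZR_le; apply/Z.leb_le;
  have := Z.mul_div_le a d d0; have := Z.mul_succ_div_gt a d d0; lia.
Qed.

Fixpoint zsumn (f : nat -> Z) (n : nat) : Z :=
  if n is m.+1 then Z.add (zsumn f m) (f m) else Z0.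

Lemma zsumn_bounds (R : realType) (f : nat -> Z) (u : nat -> R) (k e : R) (n : nat) :
  (forall i, ZR (f i) <= k * u i <= ZR (f i) + e) ->
  ZR (zsumn f n) <= k * (\sum_(i < n) u i) <= ZR (zsumn f n) + n%:R * e.
Proof.
move=> H; elim: n => [|n /andP[h1 h2]].
  by rewrite big_ord0 mulr0 mul0r addr0 -[zsumn f 0]/(Z.of_nat 0) ZR_nat lexx.
rewrite big_ord_recr/= ZRD mulrDr -natr1 mulrDl mul1r.
by have /andP[h3 h4] := H n; apply/andP; split; lra.
Qed.

(** Sums are computed in units of [10^-9]; rounding each term down costs at most one unit per
    term. *)
Definition zscale : Z := Z.pow (Z.of_nat 10) (Z.of_nat 9).

Lemma ZR_pow (R : realType) (a : Z) (n : nat) :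
  ZR (Z.pow a (Z.of_nat n)) = ZR a ^+ n :> R.
Proof.
elim: n => [|n IHn]; first by rewrite -[Z.pow _ _]/(Z.of_nat 1) ZR_nat.
by rewrite Nat2Z.inj_succ Z.pow_succ_r; [rewrite ZRM IHn exprS|lia].
Qed.

Definition zeta_floor (s i : nat) : Z :=
  Z.div zscale (Z.pow (Z.of_nat i.+1) (Z.of_nat s)).

Lemma zpart_floor_bounds (R : realType) (s n : nat) :
  ZR (zsumn (zeta_floor s) n) <= (10 ^+ 9 * zpart s n : R) <=
  ZR (zsumn (zeta_floor s) n) + n%:R.
Proof.
rewrite -[X in _ + X]mulr1; apply: (@zsumn_bounds R _ (fun i => (i.+1%:R ^+ s)^-1)) => i.
have d0 : Z.ltb Z0 (Z.pow (Z.of_nat i.+1) (Z.of_nat s)).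
  by apply/Z.ltb_lt; apply: Z.pow_pos_nonneg; lia.
have := ZR_div_bounds R zscale d0.
by rewrite /zscale !ZR_pow !ZR_nat.
Qed.

(* With x = m^2 and y = n^2, w^2 q^2 = q^2 - 4 x y turns the second derivative of
   q^-s at t = 0 into (s^2 q^2 - 4 s (s + 1) x y) / q^(s + 2). *)
Definition term_floor (s i j : nat) : Z :=
  let x := Z.pow (Z.of_nat i.+1) (Z.of_nat 2) in
  let y := Z.pow (Z.of_nat j.+1) (Z.of_nat 2) in
  let q := Z.add x y in
  Z.div (Z.mul zscale
      (Z.add (Z.mul (Z.of_nat (s * s)) (Z.mul q q))
             (Z.opp (Z.mul (Z.of_nat (4 * (s * s.+1))) (Z.mul x y)))))
    (Z.pow q (Z.of_nat s.+2)).

Lemma term_floor_bounds (R : realType) (s i j : nat) :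
  ZR (term_floor s i j) <= (10 ^+ 9 * term s (iter 2 (dpoly s) 1) 0 i j : R) <=
  ZR (term_floor s i j) + 1.
Proof.
set x := Z.pow (Z.of_nat i.+1) (Z.of_nat 2).
set y := Z.pow (Z.of_nat j.+1) (Z.of_nat 2).
have x0 : Z.lt Z0 x by apply: Z.pow_pos_nonneg; lia.
have y0 : Z.lt Z0 y by apply: Z.pow_pos_nonneg; lia.
have d0 : Z.ltb Z0 (Z.pow (Z.add x y) (Z.of_nat s.+2)).
  by apply/Z.ltb_lt; apply: Z.pow_pos_nonneg; lia.
have := ZR_div_bounds R (Z.mul zscale
      (Z.add (Z.mul (Z.of_nat (s * s)) (Z.mul (Z.add x y) (Z.add x y)))
             (Z.opp (Z.mul (Z.of_nat (4 * (s * s.+1))) (Z.mul x y))))) d0.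
rewrite -[X in ZR X <= _ <= ZR X + 1]/(term_floor s i j).
suff -> : ZR (Z.mul zscale
      (Z.add (Z.mul (Z.of_nat (s * s)) (Z.mul (Z.add x y) (Z.add x y)))
             (Z.opp (Z.mul (Z.of_nat (4 * (s * s.+1))) (Z.mul x y))))) /
   ZR (Z.pow (Z.add x y) (Z.of_nat s.+2)) =
   10 ^+ 9 * term s (iter 2 (dpoly s) 1) 0 i j :> R by [].
rewrite !ZRM !(ZR_pow, ZRD, ZRN, ZRM, ZR_nat) /term dpoly2E.
rewrite !(hornerE, hornerMn, hornerXn) /= /wf /qf oppr0 expR0 !mulr1.
have a0 : 0 < i.+1%:R :> R by [].
have b0 : 0 < j.+1%:R :> R by [].
move: (i.+1%:R : R) (j.+1%:R : R) a0 b0 => a b a0 b0.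
have q0 : a ^+ 2 + b ^+ 2 != 0 by rewrite gt_eqF// addr_gt0 ?exprn_gt0.
rewrite [_ ^+ s.+2]exprS [_ ^+ s.+1]exprS; field.
by rewrite q0 expf_neq0.
Qed.

Definition sq_floor (s n : nat) : Z :=
  zsumn (fun i => zsumn (term_floor s i) n) n.

Lemma sq_floor_bounds (R : realType) (s n : nat) :
  ZR (sq_floor s n) <=
  (10 ^+ 9 * sq_sum (term s (iter 2 (dpoly s) 1) 0) n : R) <=
  ZR (sq_floor s n) + n%:R * n%:R.
Proof.
pose u := term s (iter 2 (dpoly s) 1) (0 : R).
apply: (@zsumn_bounds R _ (fun i => \sum_(j < n) u i j)) => i.
rewrite -[X in _ + X]mulr1; apply: (@zsumn_bounds R _ (u i)) => j.
exact: term_floor_bounds.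
Qed.

Lemma sq_floor_3_40 : sq_floor 3 40 = Zneg 347523808.
Proof. by vm_compute. Qed.

Lemma sq_floor_6_40 : sq_floor 6 40 = Zneg 92561630.
Proof. by vm_compute. Qed.

Lemma zeta_floor_6_20 : zsumn (zeta_floor 6) 20 = Zpos 1017342998.
Proof. by vm_compute. Qed.

Lemma zeta_floor_12_20 : zsumn (zeta_floor 12) 20 = Zpos 1000246084.
Proof. by vm_compute. Qed.

(** The polynomial is affine in [x^2], with value [-s] at 0 and [s^2] at 1. The asymmetric range
    sharpens the lower tail bound. *)
Lemma dpoly2_range (R : realType) (s : nat) (x : R) : `|x| <= 1 ->
  - s%:R <= (iter 2 (dpoly s) 1).[x] <= s%:R ^+ 2.
Proof.
move=> /sqr_norm_le1 /andP[u0 u1]; rewrite dpoly2E !(hornerE, hornerMn, hornerXn) /=.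
rewrite -[x ^+ 2 *+ _]mulr_natr natrM -natr1.
have s0 : 0 <= s%:R :> R by [].
by move: (s%:R : R) (x ^+ 2) s0 u0 u1 => a u a0 u0 u1; apply/andP; split; nra.
Qed.

Lemma phi2_40_bounds (R : realType) (s : nat) : (3 <= s)%N ->
  (ZR (sq_floor s 40) / 10 ^+ 9 - s%:R * (4 / 40 ^+ 4) <=
   (phi s (iter 2 (dpoly s) 1) 0 : R) <=
   (ZR (sq_floor s 40) + 1600) / 10 ^+ 9 + s%:R ^+ 2 * (4 / 40 ^+ 4)).
Proof.
move=> s3.
have /andP[h1 h2] := @phi_partial_bounds R s 40 (iter 2 (dpoly s) 1) s%:R (s%:R ^+ 2)
  s3 isT (ler0n _ _) (sqr_ge0 _) (fun x => @dpoly2_range R s x).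
have /andP[h3 h4] := @sq_floor_bounds R s 40.
(* The total rounding error in units of [10^-9], one for each of the 40 by 40 terms. *)
have e : 40 * 40 = 1600 :> R by ring.
rewrite e in h4; move: (ZR _) (sq_sum _ _) (phi _ _ _) (s%:R) h1 h2 h3 h4 => z u p r.
by move=> h1 h2 h3 h4; apply/andP; split; lra.
Qed.

Lemma zsum_20_bounds (R : realType) (s : nat) : (6 <= s)%N ->
  (ZR (zsumn (zeta_floor s) 20) / 10 ^+ 9 <= (zsum s : R) <=
   (ZR (zsumn (zeta_floor s) 20) + 20) / 10 ^+ 9 + (20 ^+ 5)^-1).
Proof.
move=> s6; have s2 : (2 <= s)%N by apply: leq_trans s6.
have /andP[h1 h2] := @zsum_partial_bounds R s 20 s2 isT.
have /andP[h3 h4] := @zpart_floor_bounds R s 20.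
have h5 : (20 ^+ s.-1)^-1 <= (20 ^+ 5)^-1 :> R.
  by rewrite lef_pV2 ?posrE ?exprn_gt0// ler_weXn2l ?ler1n//; case: s s6 {s2 h1 h2 h3 h4}.
move: (ZR _) (zsum _) (zpart _ _) (_ ^- s.-1) (20 ^- 5) h1 h2 h3 h4 h5 => z u p r q.
by move=> h1 h2 h3 h4 h5; apply/andP; split; lra.
Qed.

Lemma rho0_bounds (R : realType) :
  4 + 774 / 10 ^+ 4 <= (rho0 : R) < 4 + 775 / 10 ^+ 4.
Proof.
have /andP[a1 a2] := @phi2_40_bounds R 3 isT.
have /andP[b1 b2] := @phi2_40_bounds R 6 isT.
have /andP[c1 c2] := @zsum_20_bounds R 6 isT.
have /andP[d1 d2] := @zsum_20_bounds R 12 isT.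
have g0 := @ef32_gt0 R.
rewrite sq_floor_3_40 -[Zneg _]/(Z.opp (Zpos _)) in a1 a2.
rewrite sq_floor_6_40 -[Zneg _]/(Z.opp (Zpos _)) in b1 b2.
rewrite zeta_floor_6_20 in c1 c2; rewrite zeta_floor_12_20 in d1 d2.
rewrite !ZRN !(ZR_xI, ZR_xO, ZR_xH) in a1 a2 b1 b2 c1 c2 d1 d2.
(* Clearing the positive denominator leaves inequalities linear in two lattice sums and two zeta
   values, all enclosed above. *)
rewrite /rho0 ler_pdivlMr// ltr_pdivrMr//.
rewrite /ef mulr0 oppr0 expR0 mulr0 oppr0 expR0 -[(2 * 3)%N]/6%N -[(2 * 6)%N]/12%N.
have -> : (-1) ^+ 2 = 1 :> R by ring.
move: (phi 3 _ _) (phi 6 _ _) (zsum 6) (zsum 12) a1 a2 b1 b2 c1 c2 d1 d2 {g0}.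
move=> p3 p6 z6 z12 a1 a2 b1 b2 c1 c2 d1 d2.
by apply/andP; split; lra.
Qed.

Theorem theorem6p2 (R : realType) :
  exists ba : R,
    (* b_a is the limiting value at y = 1 of the quotient of y-derivatives *)
    ((derive1 (zeta_iy 6) x / derive1 (zeta_iy 3) x) @[x --> (1 : R)^']
       --> ba)
    /\ 4 + 774 / 10 ^+ 4 <= ba < 4 + 775 / 10 ^+ 4
    (* for b <= b_a the minimum over Gamma_a is achieved at z = i *)
    /\ (forall b : R, b <= ba ->
          forall y, Gamma_a_y y -> Wb b 1 <= Wb b y)
    /\ exists yb : R -> R,
      (* for b > b_a the minimum is achieved at z = i y_b, y_b > 1,
         and i y_b is the (unique) minimizer on Gamma_a *)
      (forall b : R, ba < b ->
          1 < yb b /\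
          (forall y, Gamma_a_y y -> Wb b (yb b) <= Wb b y) /\
          (forall y, Gamma_a_y y -> Wb b y <= Wb b (yb b) -> y = yb b))
      (* d y_b / d b > 0 *)
      /\ (forall b : R, ba < b -> derivable yb b 1 /\ 0 < derive1 yb b)
      (* y_b / cbrt(xi(6) b / (2 xi(12))) -> 1 as b -> +oo *)
      /\ (yb b / ((riemann_zeta 6 / (2 * riemann_zeta 12) * b) `^ (3^-1))
            @[b --> +oo%R] --> (1 : R)).
Proof.
exists rho0; split; first exact: zeta_ratio_cvg.
split; first exact: rho0_bounds.
split; first by move=> b hb y hy; exact: Wb_min_at_1.
(* A total function is needed; for [b <= rho0] the condition is vacuous and 0 serves as witness. *)
have /choice[tau tauP] (b : R) : exists t, rho0 < b -> 0 < t /\ rho t = b.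
  have [hb|hb] := ltP rho0 b; last by exists 0.
  by have [t t0 tb] := rho_surj hb; exists t.
(* Back to the variable [y = e^t]: the minimizer is [y_b = e^(tau b)], and [y_b > 1] because
   [tau b > 0]. *)
exists (expR \o tau); split.
  move=> b hb; have [t0 tb] := tauP b hb; split; first by rewrite /= expR_gt1.
  have min_at u : 0 <= u -> u != tau b -> Wb b (expR (tau b)) < Wb b (expR u).
    by move=> u0 ut; exact: Wb_lt_min.
  split=> y /Gamma_a_expR[u u0 ->] /=.
    by have [->//|ut] := eqVneq u (tau b); apply/ltW/min_at.
  have [->//|ut] := eqVneq u (tau b).
  by rewrite leNgt min_at.
split; first by move=> b; exact: is_derive_expR_rho_inv.
rewrite -[12 : R]/(12%:R) -[6 : R]/(6%:R) !riemann_zetaE//.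
exact: rho_inv_asymptotic.
Qed.
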